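(* Take $\le$ to be the Bruhat order restricted to $\mathrm{NC}_n$. Double forest polynomials define a flowup basis for the graph cohomology ring $H^\bullet_{T_n}(\mathrm{Cayley}(\mathrm{NC}_n))$. Specifically, the elements $f_v$ ($v\in\mathrm{NC}_n$) given by $$(f_v)_w=\mathrm{ev}_w(\mathfrak{P}_F)\qquad(w\in\mathrm{NC}_n),$$ where $F\in\mathsf{Forest}_n$ is the unique forest such that $v=\mathrm{ForToNC}(F)$, form a flowup basis.
   Context: Write $\mathbf{x}_n=(x_1,\dots,x_n)$, $\mathbf{t}_n=(t_1,\dots,t_n)$. Noncrossing partitions: $w\in S_n$ lies in $\mathrm{NC}_n$ if every cycle of $w$ has the form $(b_1\cdots b_r)$ with $b_1>\cdots>b_r$ and the underlying sets of its cycles (fixed points included) form a noncrossing set partition of $\{1,\dots,n\}$. $\mathrm{Cayley}(\mathrm{NC}_n)$ is the graph on $\mathrm{NC}_n$ in which $w$ and $(i\,j)w$ are joined by an edge whenever both lie in $\mathrm{NC}_n$; this edge is labelled $t_j-t_i$ (up to sign). Graph cohomology: for a graph $G=(V,E)$ with edge labels $\chi(uv)$ nonzero linear polynomials in $\mathbb{Z}[\mathbf{t}_n]$ up to sign, $H^\bullet_{T_n}(G)=\{(f_v)_{v\in V}\in\mathbb{Z}[\mathbf{t}_n]^{\oplus V}: \chi(uv)\text{ divides }f_v-f_u\text{ for all }uv\in E\}$. Given a partial order $\le$ on $V$, a flowup basis is a collection $\{f_v: v\in V\}\subset H^\bullet_{T_n}(G)$ such that (1) $(f_v)_w=0$ if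 $v\not\le w$, and (2) $(f_v)_v=\pm\prod_{uv\in E,\,u\le v}\chi(uv)$. Evaluation: $\mathrm{ev}_w f=f(t_{w(1)},\dots,t_{w(n)};\mathbf{t}_n)$ for $f\in\mathbb{Z}[\mathbf{t}_n][\mathbf{x}_n]$. Forests: $\mathsf{Forest}_n$ is the set of ordered sequences of planar binary trees (each node is a leaf or has a left and a right child; a single leaf is allowed) with $n$ leaves in total, labelled $1,\dots,n$ from left to right. For $G\in\mathsf{Forest}_{n-1}$, $G\cdot\mathsf{e}_i\in\mathsf{Forest}_n$ is obtained by replacing the $i$th leaf by an internal node with two leaf children. The forest with no internal nodes is denoted $\emptyset$. $\mathrm{ForToNC}(F)\in\mathrm{NC}_n$ is obtained as follows: for every internal node of $F$ that is a right child of its parent, delete the edge to its left child and contract the resulting node; the leaf sets of the connected components of the result form a noncrossing partition of $\{1,\dots,n\}$, and $\mathrm{ForToNC}(F)$ is the product of the backwards cycles on these sets. $\mathrm{ForToNC}:\mathsf{Forest}_n\to\mathrm{NC}_n$ is a bijection. Double forest polynomials: for $f\in\mathbb{Z}[\mathbf{t}_n][\mathbf{x}_n]$ and $1\le i\le n-1$ put $\mathsf{E}_if=\frac{f(x_1,\dots,x_i,t_i,x_{i+1},\dots,x_{n-1};\mathbf{t}_n)-f(x_1,\dots,x_{i-1},t_i,x_i,\dots,x_{n-1};\mathbf{t}_n)}{x_i-t_i}$. The $\mathfrak{P}_F$ are the unique family $\{\mathfrak{P}_F(\mathbf{x}_n;\mathbf{t}_n): n\ge1, F\in\mathsf{Forest}_n\}$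 such that each $\mathfrak{P}_F(\mathbf{x}_n;\mathbf{t}_n)\in\mathbb{Z}[\mathbf{t}_n][\mathbf{x}_n]$ does not depend on $x_n$, $\mathfrak{P}_F(\mathbf{t}_n;\mathbf{t}_n)=\delta_{F,\emptyset}$, and for $1\le i\le n-1$, $\mathsf{E}_i\mathfrak{P}_F=\mathfrak{P}_G(x_1,\dots,x_{n-1};t_1,\dots,t_{i-1},t_{i+1},\dots,t_n)$ if $F=G\cdot\mathsf{e}_i$ with $G\in\mathsf{Forest}_{n-1}$, and $\mathsf{E}_i\mathfrak{P}_F=0$ otherwise. *)

(* Defs.v *)
From HB Require Import structures.
From mathcomp Require Import all_boot all_order all_algebra all_fingroup.
From mathcomp Require Export mpoly.

Set Implicit Arguments.
Unset Strict Implicit.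
Unset Printing Implicit Defensive.

Import GRing.Theory.
Local Open Scope ring_scope.

(* Indices are shifted by one: the index set {1, ..., n} is ['I_n].
   Z[t_n] is [{mpoly int[n]}] and Z[t_n][x_n] is [{mpoly {mpoly int[n]}[n]}].
   In MathComp [(s * t)%g] applies [s] first, so the product written (i j)w
   with functions composed from right to left is [(w * tperm i j)%g]. *)

Notation "'Zt[ n ]" := {mpoly int[n]} (at level 0, format "''Zt[' n ]").
Notation "'Ztx[ n , k ]" := {mpoly {mpoly int[n]}[k]}
  (at level 0, format "''Ztx[' n ,  k ]").

(* b_1 -> b_2 -> ... -> b_r -> b_1 for A = {b_1 > ... > b_r}; [enum A] is
   increasing, and points outside A are fixed by [prev]. *)
Definition backward_cycle n (A : {set 'I_n}) : 'S_n :=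
  perm (can_inj (next_prev (enum_uniq A))).

Definition noncrossing n (P : {set {set 'I_n}}) : bool :=
  [forall B in P, forall C in P, (B != C) ==>
    ~~ [exists a in B, exists b in C, exists c in B, exists d in C,
         [&& (a < b)%N, (b < c)%N & (c < d)%N]]].

Definition is_NC n (w : 'S_n) : bool :=
  [forall C in porbits w, forall x in C, w x == backward_cycle C x]
  && noncrossing (porbits w).

Definition NC n := {w : 'S_n | is_NC w}.
HB.instance Definition _ n := Finite.on (NC n).

Definition perm_length n (w : 'S_n) : nat :=
  #|[set p : 'I_n * 'I_n | (p.1 < p.2)%N && (w p.2 < w p.1)%N]|.

Definition bruhat_step n (u v : 'S_n) : bool :=
  [exists i, exists j, v == (u * tperm i j)%g]
  && (perm_length u < perm_length v)%N.

Definition bruhat n : rel 'S_n := connect (@bruhat_step n).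

Definition NC_bruhat n : rel (NC n) := fun u v => bruhat (val u) (val v).

Record labelled_graph n := LabelledGraph {
  vertex :> finType;
  edge : rel vertex;
  label : vertex -> vertex -> 'Zt[n];
  edge_sym : forall u v, edge u v = edge v u;
  edge_irr : irreflexive edge;
  (* [msize] is one more than the degree *)
  label_linear : forall u v, edge u v -> msize (label u v) = 2%N;
  label_sym : forall u v,
    edge u v -> label v u = label u v \/ label v u = - label u v }.

Definition mpoly_divides n (p q : 'Zt[n]) : Prop := exists r, q = r * p.

Definition graph_cohomology n (G : labelled_graph n) (f : G -> 'Zt[n]) : Prop :=
  forall u v : G, edge u v -> mpoly_divides (label u v) (f v - f u).

(* [f v w] stands for (f_v)_w. *)
Definition flowup_basis n (G : labelled_graph n) (le : rel G)
    (f : G -> G -> 'Zt[n]) : Prop :=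
  [/\ forall v, graph_cohomology (f v),
      forall v w, ~~ le v w -> f v w = 0
    & forall v, exists s : bool,
        f v v = (-1) ^+ s * \prod_(u : G | edge u v && le u v) label u v].

Definition differ_by n (u v : NC n) (p : 'I_n * 'I_n) : bool :=
  (p.1 < p.2)%N && (val v == (val u * tperm p.1 p.2)%g).

Definition cayley_edge n : rel (NC n) := fun u v => [exists p, differ_by u v p].

Definition cayley_label n (u v : NC n) : 'Zt[n] :=
  if [pick p | differ_by u v p] is Some p then 'X_p.2 - 'X_p.1 else 0.

Lemma differ_by_sym n (u v : NC n) : differ_by u v =1 differ_by v u.
Proof.
by move=> p; congr (_ && _); apply/eqP/eqP=> ->; rewrite -mulgA tperm2 mulg1.
Qed.

Lemma cayley_edge_sym n (u v : NC n) : cayley_edge u v = cayley_edge v u.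
Proof. by apply: eq_existsb; apply: differ_by_sym. Qed.

Lemma cayley_edge_irr n : irreflexive (@cayley_edge n).
Proof.
move=> u; apply/existsP=> -[[i j] /andP[/= lt_ij /eqP/(congr1 (mulg (val u)^-1%g))]].
rewrite mulgA mulVg mul1g => /permP/(_ i); rewrite perm1 tpermL => eq_ij.
by rewrite eq_ij ltnn in lt_ij.
Qed.

Lemma cayley_label_linear n (u v : NC n) :
  cayley_edge u v -> msize (cayley_label u v) = 2%N.
Proof.
rewrite /cayley_label => /existsP[q uvq].
case: pickP => [[i j] /andP[/= lt_ij _]|/(_ q)]; last by rewrite uvq.
apply/eqP; rewrite eqn_leq; apply/andP; split.
  by apply: leq_trans (msizeD_le _ _) _; rewrite mmeasureN !msizeX !mdeg1.
rewrite ltnNge; apply/negP=> /msize1_polyC/(congr1 (mcoeff U_(j))).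
rewrite mcoeffB !mcoeffX mcoeffC mnm1_eq0 eqxx mulr0.
have -> : (U_(i) == U_(j) :> 'X_{1..n})%MM = false.
  apply/negbTE/eqP=> /mnmP/(_ i); rewrite !mnm1E eqxx.
  by case: eqP lt_ij => // ->; rewrite ltnn.
by rewrite subr0.
Qed.

Lemma cayley_label_sym n (u v : NC n) : cayley_edge u v ->
  cayley_label v u = cayley_label u v \/ cayley_label v u = - cayley_label u v.
Proof.
by left; rewrite /cayley_label (eq_pick (differ_by_sym v u)).
Qed.

Definition cayley_NC n : labelled_graph n :=
  LabelledGraph (@cayley_edge_sym n) (@cayley_edge_irr n)
    (@cayley_label_linear n) (@cayley_label_sym n).

Inductive tree := Leaf | Node of tree & tree.

Fixpoint leaves (t : tree) : nat :=
  if t is Node l r then (leaves l + leaves r)%N else 1%N.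

Fixpoint tree_code (t : tree) : bitseq :=
  if t is Node l r then true :: tree_code l ++ tree_code r else [:: false].

Definition forest_code (s : seq tree) : bitseq := flatten (map tree_code s).

Definition forest_decode : bitseq -> seq tree :=
  foldr (fun b s => if b then if s is l :: r :: s' then Node l r :: s' else s
                    else Leaf :: s) [::].

Lemma tree_codeK t c : forest_decode (tree_code t ++ c) = t :: forest_decode c.
Proof.
by elim: t c => [|l IHl r IHr] c //=; rewrite -catA IHl IHr.
Qed.

Lemma forest_codeK : cancel forest_code forest_decode.
Proof. by elim=> //= t s IHs; rewrite tree_codeK IHs. Qed.

Lemma tree_code_pcan : pcancel tree_code (ohead \o forest_decode).
Proof. by move=> t /=; rewrite -[tree_code t]cats0 tree_codeK. Qed.

HB.instance Definition _ := Countable.copy tree (pcan_type tree_code_pcan).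

Lemma size_forest_code s :
  (size (forest_code s) <= (sumn (map leaves s)).*2)%N.
Proof.
have size_code t : (size (tree_code t) < (leaves t).*2)%N.
  elim: t => //= l IHl r IHr; rewrite size_cat doubleD.
  by rewrite -addnS -addSn leq_add.
elim: s => //= t s IHs; rewrite /forest_code /= size_cat doubleD.
by rewrite leq_add // ltnW.
Qed.

Record Forest n := MkForest {
  trees :> seq tree;
  _ : sumn (map leaves trees) == n }.

HB.instance Definition _ n := [isSub for @trees n].
HB.instance Definition _ n := [Countable of Forest n by <:].

Fact Forest_code_subproof n (F : Forest n) : (size (forest_code F) <= n.*2)%N.
Proof. by rewrite -[n in (_ <= n.*2)%N](eqP (valP F)) size_forest_code. Qed.

Definition Forest_code n (F : Forest n) : n.*2.-bseq bool :=
  Bseq (Forest_code_subproof F).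

Definition Forest_decode n (c : n.*2.-bseq bool) : option (Forest n) :=
  insub (forest_decode c).

Lemma Forest_codeK n : pcancel (@Forest_code n) (@Forest_decode n).
Proof. by move=> F; rewrite /Forest_decode /= forest_codeK; apply: valK. Qed.

HB.instance Definition _ n : isFinite (Forest n) := PCanIsFinite (@Forest_codeK n).

Fact empty_forest_subproof n : sumn (map leaves (nseq n Leaf)) == n.
Proof. by rewrite map_nseq sumn_nseq /= mul1n. Qed.

Definition empty_forest n : Forest n := MkForest (empty_forest_subproof n).

Fixpoint grow_tree (i : nat) (t : tree) : tree :=
  if t is Node l r then
    if (i < leaves l)%N then Node (grow_tree i l) r
    else Node l (grow_tree (i - leaves l) r)
  else Node Leaf Leaf.

Fixpoint grow_seq (i : nat) (s : seq tree) : seq tree :=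
  if s is t :: s' then
    if (i < leaves t)%N then grow_tree i t :: s'
    else t :: grow_seq (i - leaves t) s'
  else [::].

Fact grow_subproof n (G : Forest n) (i : 'I_n) :
  sumn (map leaves (grow_seq i G)) == n.+1.
Proof.
have leaves_grow t k : (k < leaves t)%N -> leaves (grow_tree k t) = (leaves t).+1.
  elim: t k => //= l IHl r IHr k lt_k.
  case: ltnP => [lt_kl | le_lk] /=; first by rewrite IHl.
  by rewrite IHr ?addnS // ltn_subLR.
case: G i => s /= /eqP <- [i /=].
elim: s i => //= t s IHs i lt_i.
case: ltnP => [lt_it | le_ti] /=; first by rewrite leaves_grow.
by rewrite (eqP (IHs _ _)) ?addnS // ltn_subLR.
Qed.

(* G . e_i *)
Definition grow n (G : Forest n) (i : 'I_n) : Forest n.+1 :=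
  MkForest (grow_subproof G i).

(* The leaves of [t] are labelled o, o + 1, ... from left to right, and
   [is_right] says whether the root of [t] is a right child.  When it is an
   internal right child, the edge from the root to its left child is deleted.
   The result is the leaf set of the connected component of the root, and the
   list of the leaf sets of the other components; contracting the root
   afterwards changes none of these. *)
Fixpoint tree_blocks (is_right : bool) (o : nat) (t : tree) :
    seq nat * seq (seq nat) :=
  if t is Node l r then
    let: (bl, sl) := tree_blocks false o l in
    let: (br, sr) := tree_blocks true (o + leaves l) r in
    if is_right then (br, bl :: sl ++ sr) else (bl ++ br, sl ++ sr)
  else ([:: o], [::]).

Fixpoint forest_blocks (o : nat) (s : seq tree) : seq (seq nat) :=
  if s is t :: s' then
    let: (b, bs) := tree_blocks false o t in
    b :: bs ++ forest_blocks (o + leaves t) s'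
  else [::].

Definition ForToNC n (F : Forest n) : 'S_n :=
  (\prod_(B <- forest_blocks 0 F) backward_cycle [set i : 'I_n | val i \in B])%g.

(* The unique forest mapped to v; the default value is never used, since
   [ForToNC] is a bijection onto NC_n. *)
Definition NCToFor n (v : NC n) : Forest n :=
  odflt (empty_forest n) [pick F : Forest n | ForToNC F == val v].

(* f(x_1, ..., x_m, with c inserted at position h; t) *)
Definition insert_at (R : comNzRingType) m (h : 'I_m.+1) (c : R)
    (f : {mpoly R[m.+1]}) : {mpoly R[m]} :=
  f \mPo [tuple (if unlift h j is Some k then 'X_(k : 'I_m) else c%:MP)
          | j < m.+1].

Lemma insert_at_dvd (R : comNzRingType) m (i : 'I_m) (c : R)
    (f : {mpoly R[m.+1]}) :
  exists g : {mpoly R[m]}, g * ('X_i - c%:MP) =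
    insert_at (lift ord0 i) c f - insert_at (widen_ord (leqnSn m) i) c f.
Proof.
rewrite /insert_at; set h := widen_ord _ i.
set s1 := mktuple _; set s2 := mktuple _.
have lift_eq : lift h i = lift ord0 i.
  by apply/val_inj; rewrite /= /bump leqnn.
have lift_eq' : h = lift (lift ord0 i) i.
  by apply/val_inj; rewrite /= /bump ltnn.
have unlift_h : unlift (lift ord0 i) h = Some i by rewrite lift_eq' liftK.
have lift_neq k : k != i -> lift h k = lift (lift ord0 i) k.
  rewrite -val_eqE => /= neq_ki; apply/val_inj; rewrite /= /bump add1n.
  by rewrite leq_eqVlt eq_sym (negbTE neq_ki).
have gen j : exists g, g * ('X_i - c%:MP) = tnth s1 j - tnth s2 j.
  rewrite !tnth_mktuple; case: (unliftP h j) => [k|] ->; last first.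
    by exists 1; rewrite mul1r unlift_h.
  have [-> | neq_ki] := eqVneq k i.
    by exists (-1); rewrite lift_eq unlift_none mulN1r opprB.
  by exists 0; rewrite mul0r lift_neq // liftK subrr.
pose D (p : {mpoly R[m.+1]}) :=
  exists g, g * ('X_i - c%:MP) = (p \mPo s1) - (p \mPo s2).
have DC a : D a%:MP by exists 0; rewrite !comp_mpolyC mul0r subrr.
have DM p q : D p -> D q -> D (p * q).
  move=> [g1 e1] [g2 e2]; exists (g1 * (q \mPo s1) + g2 * (p \mPo s2)).
  rewrite !rmorphM /= mulrDl mulrAC e1 mulrAC e2.
  rewrite !mulrBl [(q \mPo s1) * (p \mPo s2)]mulrC addrA subrK.
  by rewrite [(q \mPo s2) * _]mulrC.
have DD p q : D p -> D q -> D (p + q).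
  move=> [g1 e1] [g2 e2]; exists (g1 + g2).
  by rewrite !rmorphD /= mulrDl e1 e2 addrACA opprD.
suff : D f by [].
elim/mpolyind: f => [|a mm p _ _ Dp]; first by rewrite -mpolyC0; apply: DC.
apply: DD Dp; rewrite -mul_mpolyC; apply: (DM); first exact: DC.
rewrite mpolyXE_id; apply: big_ind => [||j _].
- by rewrite -mpolyC1; apply: DC.
- exact: DM.
elim: (mm j) => [|k IHk]; first by rewrite expr0 -mpolyC1; apply: DC.
rewrite exprS; apply: (DM) => //; have [g eg] := gen j; exists g.
by rewrite !comp_mpolyXU -!tnth_nth.
Qed.

(* Here n = m.+1, and i : 'I_m is an index 1 <= i <= n - 1; [widen_ord] is the
   same index viewed in {1, ..., n} and [lift ord0 i] is the index i + 1. *)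
Definition E_num m (i : 'I_m) (f : 'Ztx[m.+1, m.+1]) : 'Ztx[m.+1, m] :=
  let h := widen_ord (leqnSn m) i in
  insert_at (lift ord0 i) 'X_h f - insert_at h 'X_h f.

Definition E_den m (i : 'I_m) : 'Ztx[m.+1, m] :=
  'X_i - ('X_(widen_ord (leqnSn m) i))%:MP.

Fact E_subproof m (i : 'I_m) (f : 'Ztx[m.+1, m.+1]) :
  exists g, g * E_den i == E_num i f.
Proof.
by have [g eq_g] := insert_at_dvd i 'X_(widen_ord _ i) f; exists g; apply/eqP.
Qed.

(* The quotient of [E_num i f] by x_i - t_i, which is an exact division. *)
Definition E m (i : 'I_m) (f : 'Ztx[m.+1, m.+1]) : 'Ztx[m.+1, m] :=
  xchoose (E_subproof i f).

Lemma E_spec m (i : 'I_m) (f : 'Ztx[m.+1, m.+1]) :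
  E i f * E_den i = E_num i f.
Proof. exact/eqP/(xchooseP (E_subproof i f)). Qed.

(* f(x; t_1, ..., t_{h-1}, t_{h+1}, ..., t_n) *)
Definition skip_t m k (h : 'I_m.+1) (f : 'Ztx[m, k]) : 'Ztx[m.+1, k] :=
  map_mpoly (fun c => c \mPo [tuple 'X_(lift h j) | j < m]) f.

(* f(t_{w(1)}, ..., t_{w(n)}; t) *)
Definition ev n (w : 'S_n) (f : 'Ztx[n, n]) : 'Zt[n] := f.@[fun k => 'X_(w k)].

Definition free_of (R : nzRingType) n (h : 'I_n) (f : {mpoly R[n]}) : Prop :=
  forall mm, mm \in msupp f -> mm h = 0%N.

(* Nothing is required of P at n = 0: the family is indexed by n >= 1. *)
Definition double_forest_polynomials
    (P : forall n, Forest n -> 'Ztx[n, n]) : Prop :=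
  forall m (F : Forest m.+1),
    [/\ free_of ord_max (P _ F),
        (P _ F).@[fun k => 'X_k] = (F == empty_forest m.+1)%:R,
        forall (i : 'I_m) (G : Forest m), F = grow G i ->
          E i (P _ F) = skip_t (widen_ord (leqnSn m) i) (P _ G)
      & forall i : 'I_m, (forall G : Forest m, F <> grow G i) ->
          E i (P _ F) = 0].

Definition forest_class (P : forall n, Forest n -> 'Ztx[n, n]) n
    (v w : NC n) : 'Zt[n] :=
  ev (val w) (P n (NCToFor v)).

(* Main.v *)
Require Import Defs.
From mathcomp Require Import all_boot all_algebra all_fingroup zify.

(** Deleting one position and one value relates permutations of n to those of
    n - 1.  Given w and an index i, inserting i either as a fixed point or as
    the value at position i + 1 yields two permutations that differ by the
    transposition of the positions i and i + 1, and evaluating the defining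
    equation of [E i] compares the values of a polynomial at these two with a
    value of its image under [E i] at w ([ev_long_insert]).  Hence a double
    forest polynomial takes the same value at both, unless its forest is some
    [grow G i]; then the difference is a single factor, a difference of two
    variables, times the value at w of the polynomial of G.

    Call the two permutations long and short, according to Bruhat length.  The
    proof rests on three observations about the long one.
    - The noncrossing partition of [grow G i] is the long insertion of i into
      that of G ([ForToNC_grow]).
    - Every noncrossing partition other than the identity is a long insertion
      into a smaller one ([nc_arcs_long_insert]): take the first position p
      whose value is less than p, and put i = p - 1.  It follows that every
      noncrossing partition comes from a forest.
    - Long insertion is monotone for the Bruhat order ([bruhat_long_insert]),
      by the lifting property, and short insertion lies below it.

    Vanishing ([forest_vanishing]) is then an induction on n and on the length
    of w: if the value at a long insertion is nonzero, then so is the value at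
    the short insertion, or the value of the polynomial of G at the smaller
    permutation, and either way the partition of the forest lies below.

    For the diagonal values ([forest_diagonal]) the value at the short
    insertion vanishes, so each growth step multiplies by one factor.  The
    product of the labels of the lower edges obeys the same recursion
    ([descent_product_long_insert]): transposing two positions of a long
    insertion, neither of them the inserted one, amounts to transposing two
    positions of the smaller permutation, and among the length-decreasing
    transpositions that move the inserted position only the one giving the
    short insertion stays noncrossing ([nc_swap_inserted]).

    The divisibility conditions hold for any polynomial, because transposing a
    and b changes each argument by a multiple of t_b - t_a. *)

Set Implicit Arguments.
Unset Strict Implicit.
Unset Printing Implicit Defensive.

(** * Noncrossing partitions described arc by arc *)

(** [y] precedes [x] in the cyclic order of [C]: it is the next smaller element,
    or the largest one when [x] is the smallest. *)
Definition cyclic_pred n (C : {set 'I_n}) (x y : 'I_n) : Prop :=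
  y \in C /\
  ((y < x)%N /\ (forall z, z \in C -> ~~ (y < z < x)%N)
   \/ forall z, z \in C -> (x <= z <= y)%N).

Lemma cyclic_pred_uniq n (C : {set 'I_n}) (x y y' : 'I_n) :
  x \in C -> cyclic_pred C x y -> cyclic_pred C x y' -> y = y'.
Proof.
move=> xC [yC hy] [y'C hy']; apply: val_inj => /=.
case: hy => [[lt_yx nb]|mx]; case: hy' => [[lt_yx' nb']|mx'].
- by have := nb _ y'C; have := nb' _ yC; lia.
- by have := mx' _ yC; lia.
- by have := mx _ y'C; lia.
- by have := mx _ y'C; have := mx' _ yC; lia.
Qed.

Lemma sorted_enum n (C : {set 'I_n}) :
  sorted (fun x y : 'I_n => (x < y)%N) (enum C).
Proof.
rewrite {1}/enum_mem; apply: sorted_filter => [y x z|]; first exact: ltn_trans.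
rewrite -enumT -[sorted _ _]/(sorted (relpre val ltn) _) -sorted_map
  val_enum_ord.
exact: iota_ltn_sorted.
Qed.

Lemma backward_cycle_pred n (C : {set 'I_n}) (x : 'I_n) :
  x \in C -> cyclic_pred C x (backward_cycle C x).
Proof.
rewrite /backward_cycle permE -mem_enum => xC.
split; first by rewrite -mem_enum mem_prev.
rewrite prev_nth xC.
have mC z : z \in C -> z \in enum C by rewrite mem_enum.
move: (sorted_enum C) (enum_uniq C) xC mC; case: (enum C) => // y q.
set lt := fun _ _ => _.
have lt_tr : transitive lt by move=> b a c; apply: ltn_trans.
move=> srt uq xq mC.
have pw : forall i j, (i < j)%N -> (j < (size q).+1)%N ->
    (nth y (y :: q) i < nth y (y :: q) j)%N.
  move=> i j lt_ij lt_jq.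
  by apply: (sorted_ltn_nth lt_tr y srt);
    rewrite ?unfold_in /= ?(ltn_trans lt_ij lt_jq).
have idx z : z \in C -> exists2 k, (k < (size q).+1)%N & z = nth y (y :: q) k.
  by move/mC=> zq; exists (index z (y :: q)); rewrite ?index_mem ?nth_index.
have [xq'|xNq'] := boolP (x \in q); last first.
  (* [x] is then the head, and [index x q] is the index of the last element *)
  right; have -> : x = y by apply/eqP; move: xq xNq'; rewrite inE;
    case: (x == y) => //= ->.
  move=> z /idx[k lt_kq ->]; have -> : index y q = size q.
    by apply/eqP; rewrite eqn_leq index_size leqNgt index_mem;
      move: uq => /= /andP[].
  apply/andP; split; first by case: k lt_kq => // k lt_kq; apply/ltnW/(pw 0).
  have [->//|neq_kq] := eqVneq k (size q); apply/ltnW/pw; lia.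
left; have lt_jq : (index x q < size q)%N by rewrite index_mem.
have def_x : x = nth y (y :: q) (index x q).+1 by rewrite /= nth_index.
move: (index x q) def_x lt_jq => j def_x lt_jq {xq xq'}.
split; first by rewrite def_x; exact: pw.
move=> z /idx[k lt_kq ->]; rewrite def_x; apply/negP => /andP[lt1 lt2].
have lt_jk : (j < k)%N.
  rewrite ltnNge; apply/negP; rewrite leq_eqVlt => /orP[/eqP e|lt_kj].
    by rewrite e ltnn in lt1.
  by have := ltn_trans lt1 (pw _ _ lt_kj (leqW lt_jq)); rewrite ltnn.
suff : (k < j.+1)%N by lia.
rewrite ltnNge; apply/negP; rewrite leq_eqVlt => /orP[/eqP e|lt_jk'].
  by rewrite e ltnn in lt2.
by have := ltn_trans lt2 (pw _ _ lt_jk' lt_kq); rewrite ltnn.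
Qed.

(** Both conditions say that [w] preserves what the arc from [x] backwards
    around the circle to [w x] cuts off.  For [w x < x] that is the open
      interval
    between them; for [x <= w x] the arc passes from 1 to n, and the complement
    of what it sweeps is the closed interval.  Being pairwise conditions on the
    values of [w], they behave well under insertions and transpositions, unlike
    a condition on orbits. *)
Definition nc_arcs n (w : 'S_n) : Prop := forall x y : 'I_n,
  ((w x < y < x)%N -> (w x < w y < x)%N) /\
  ((x <= y <= w x)%N -> (x <= w y <= w x)%N).

Lemma porbit_stable n (w : 'S_n) (S : pred 'I_n) (x z : 'I_n) :
  (forall y, S y -> S (w y)) -> S x -> z \in porbit w x -> S z.
Proof.
move=> stS Sx /porbitP[k ->].
by elim: k => [|k IHk]; rewrite ?expg0 ?perm1 // expgSr permM; apply: stS.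
Qed.

Lemma porbit_step n (w : 'S_n) (x y : 'I_n) :
  x \in porbit w y -> w x \in porbit w y.
Proof. by rewrite -!eq_porbit_mem -(porbit_perm w 1 x) expg1. Qed.

(** The orbit of [x] cannot leave the interval cut off by the arc at [x], nor
    enter it from outside. *)
Lemma nc_arcs_pred n (w : 'S_n) (x : 'I_n) :
  nc_arcs w -> cyclic_pred (porbit w x) x (w x).
Proof.
move=> nc; split; first by rewrite porbit_step ?porbit_id.
have [lt_wx|le_xw] := ltnP (w x) x.
  left; split=> // z zx; apply/negP => z_in.
  have: (w x < x < x)%N; last by lia.
  apply: (porbit_stable (S := fun y : 'I_n => (w x < y < x)%N) (x := z)) z_in _.
    by move=> y; apply: (proj1 (nc x y)).
  by rewrite porbit_sym.
right=> z; apply: (porbit_stable (S := fun y : 'I_n => (x <= y <= w x)%N)).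
  by move=> y; apply: (proj2 (nc x y)).
by rewrite leqnn.
Qed.

(** Left to right, an arc leaving an interval would give four interleaved
    points.  Right to left, for interleaved a < b < c < d take the least x > b
    in the block of a and c: its arc jumps over b, hence over the whole block
    of b, although d lies beyond x. *)
Lemma is_NCP n (w : 'S_n) : is_NC w <-> nc_arcs w.
Proof.
have orb x : porbit w x \in porbits w by apply: imset_f.
split=> [/andP[/forall_inP cyc /forall_inP ncr]|nc].
  have step x : cyclic_pred (porbit w x) x (w x).
    have /forall_inP/(_ x (porbit_id w x))/eqP-> := cyc _ (orb x).
    exact/backward_cycle_pred/porbit_id.
  have wrb x y : y \notin porbit w x -> w y \notin porbit w x.
    rewrite -!eq_porbit_mem -(porbit_perm w 1 y) expg1 //.
  have cross a b c d x y : y \notin porbit w x -> a \in porbit w x ->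
      b \in porbit w y -> c \in porbit w x -> d \in porbit w y ->
      (a < b)%N -> (b < c)%N -> (c < d)%N -> False.
    move=> yNx ax b_y cx dy ab bc cd.
    have := ncr _ (orb x).
    move/forall_inP/(_ _ (orb y))/implyP.
    case: eqP => [e|_ /(_ isT)/negP[]]; first by rewrite e porbit_id in yNx.
    apply/exists_inP; exists a => //; apply/exists_inP; exists b => //.
    by apply/exists_inP; exists c => //; apply/exists_inP; exists d => //;
      apply/and3P.
  have neq_val a b x :
      a \notin porbit w x -> b \in porbit w x -> val a != val b.
    by move=> aN b_x; apply: contraNneq aN => /val_inj->.
  move=> x y; have [wxx stx] := step x; split=> /andP[lt1 lt2].
    have yN : y \notin porbit w x.
      apply/negP => yx; case: stx => [[_ /(_ _ yx)]|/(_ x (porbit_id w x))];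
        lia.
    have wyN := wrb _ _ yN; have wyy := (step y).1.
    have ne1 := neq_val _ _ _ wyN wxx;
      have ne2 := neq_val _ _ _ wyN (porbit_id w x).
    apply/andP; split; rewrite ltnNge; apply/negP => h.
      apply: (cross _ _ _ _ y x _ wyy wxx (porbit_id w y) (porbit_id w x)) => //.
        by rewrite porbit_sym.
      by rewrite ltn_neqAle ne1.
    apply: (cross _ _ _ _ x y yN wxx (porbit_id w y) (porbit_id w x) wyy) => //.
    by rewrite ltn_neqAle eq_sym ne2.
  have bnd z : z \in porbit w x -> (x <= z <= w x)%N.
    case: stx => [[lt_wx _]|bnd zx]; last exact: bnd.
    by have := leq_ltn_trans (leq_trans lt1 lt2) lt_wx; rewrite ltnn.
  have [yx|yN] := boolP (y \in porbit w x).
    by apply: bnd; apply: porbit_step.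
  have wyN := wrb _ _ yN; have wyy := (step y).1.
  have ne1 := neq_val _ _ _ yN wxx;
    have ne2 := neq_val _ _ _ yN (porbit_id w x).
  apply/andP; split; rewrite leqNgt; apply/negP => h.
    apply: (cross _ _ _ _ y x _ wyy (porbit_id w x) (porbit_id w y) wxx) => //.
    - by rewrite porbit_sym.
    - by rewrite ltn_neqAle eq_sym ne2.
    - by rewrite ltn_neqAle ne1.
  apply: (cross _ _ _ _ x y yN (porbit_id w x) (porbit_id w y) wxx wyy) => //.
    by rewrite ltn_neqAle eq_sym ne2.
  by rewrite ltn_neqAle ne1.
apply/andP; split.
  apply/forall_inP => _ /imsetP[x0 _ ->]; apply/forall_inP => x xx0.
  have <- : porbit w x = porbit w x0 by apply/eqP; rewrite eq_porbit_mem.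
  apply/eqP/(cyclic_pred_uniq (porbit_id w x)); first exact: nc_arcs_pred.
  exact/backward_cycle_pred/porbit_id.
apply/forall_inP => _ /imsetP[x0 _ ->]; apply/forall_inP => _ /imsetP[y0 _ ->].
apply/implyP => neq; apply/negP.
move=> /exists_inP[a ax] /exists_inP[b b_y] /exists_inP[c cx] /exists_inP[d dy].
case/and3P=> ab bc cd.
have bN : b \notin porbit w x0.
  apply: contra neq; rewrite -eq_porbit_mem => /eqP <-.
  by rewrite eq_porbit_mem.
pose above (z : 'I_n) := (z \in porbit w x0) && (b < z)%N.
have above_c : above c by rewrite /above cx.
case: (arg_minnP (fun z : 'I_n => val z) above_c) => x /andP[xx0 bx] minx.
have xc : (x <= c)%N := minx _ above_c.
have ox : porbit w x = porbit w x0 by apply/eqP; rewrite eq_porbit_mem.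
have [wxx stx] := nc_arcs_pred x nc; rewrite ox in wxx stx.
case: stx => [[lt_wx _]|/(_ a ax)]; last by lia.
have lt_wb : (w x < b)%N.
  rewrite ltnNge; apply/negP => le_b; have ne : val b != val (w x).
    by apply: contraNneq bN => /val_inj ->.
  have : above (w x) by rewrite /above wxx ltn_neqAle ne.
  by move/minx => /=; lia.
suff : (w x < d < x)%N by lia.
apply: (porbit_stable (S := fun y : 'I_n => (w x < y < x)%N) (x := b) (w := w)).
- by move=> y; apply: (proj1 (nc x y)).
- by rewrite lt_wb.
by rewrite -eq_porbit_mem; move: dy; rewrite -eq_porbit_mem => /eqP ->;
  rewrite eq_porbit_mem porbit_sym.
Qed.

(** * Inserting a value into a permutation *)

(* The index [i] and its successor, in a set with one more element. *)
Local Notation lo i := (widen_ord (leqnSn _) i).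
Local Notation hi i := (lift ord0 i).

(** In terms of partitions: [insert_fixed] adds a new singleton, which pushes
    [i] and the larger elements up by one; [insert_descent] adds the new element
    to the block of the old [i], just below it. *)
Definition insert_fixed m (i : 'I_m) (w : 'S_m) : 'S_m.+1 :=
  lift_perm (lo i) (lo i) w.

Definition insert_descent m (i : 'I_m) (w : 'S_m) : 'S_m.+1 :=
  lift_perm (hi i) (lo i) w.

(** Both insertions have, at positions [lo i] and [hi i], the new value and the
    value that [w] takes at [i]; the long one has the larger of the two first. *)
Definition long_insert m (i : 'I_m) (w : 'S_m) : 'S_m.+1 :=
  if (w i < i)%N then insert_fixed i w else insert_descent i w.

Definition short_insert m (i : 'I_m) (w : 'S_m) : 'S_m.+1 :=
  if (w i < i)%N then insert_descent i w else insert_fixed i w.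

Lemma lift_lo_self m (i : 'I_m) : lift (lo i) i = hi i.
Proof. by apply: val_inj; rewrite /= /bump leqnn. Qed.

Lemma lift_hi_self m (i : 'I_m) : lift (hi i) i = lo i.
Proof. by apply: val_inj; rewrite /= /bump; lia. Qed.

Lemma lift_hi_lo m (i z : 'I_m) : z != i -> lift (hi i) z = lift (lo i) z.
Proof.
by rewrite -val_eqE => ne; apply: val_inj; move: ne; rewrite /= /bump; lia.
Qed.

(** The two insertions are the cases where [g] is [h] or its successor.  In
    both, lifting arguments by [g] and values by [h] preserves and reflects all
    the comparisons that occur in [nc_arcs]. *)
Lemma nc_arcs_lift m (g h : 'I_m.+1) (w : 'S_m) :
  (h <= g <= h.+1)%N -> nc_arcs (lift_perm g h w) <-> nc_arcs w.
Proof.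
move=> gh; split=> nc x y.
  have [nc1 nc2] := nc (lift g x) (lift g y).
  move: nc1 nc2; rewrite !lift_perm_lift /= /bump.
  by split; lia.
case: (unliftP g x) => [x'|] ->; case: (unliftP g y) => [y'|] ->.
- have := nc x' y'; rewrite !lift_perm_lift /= /bump; lia.
- by rewrite !lift_perm_lift lift_perm_id /= /bump; lia.
- by rewrite !lift_perm_lift lift_perm_id /= /bump; lia.
- by rewrite lift_perm_id; lia.
Qed.

Lemma insert_descentE m (i : 'I_m) (w : 'S_m) :
  insert_descent i w = (tperm (lo i) (hi i) * insert_fixed i w)%g.
Proof.
apply/permP=> x; rewrite permM /insert_fixed /insert_descent.
case: (unliftP (hi i) x) => [x'|] ->; last by rewrite tpermR !lift_perm_id.
rewrite lift_perm_lift; have [->|ne] := eqVneq x' i.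
  by rewrite lift_hi_self tpermL -lift_lo_self lift_perm_lift.
rewrite lift_hi_lo // tpermD ?neq_lift // ?lift_perm_lift //.
by rewrite -lift_lo_self (inj_eq lift_inj) eq_sym.
Qed.

Lemma long_insertE m (i : 'I_m) (w : 'S_m) :
  long_insert i w = (tperm (lo i) (hi i) * short_insert i w)%g.
Proof.
by rewrite /long_insert /short_insert insert_descentE; case: ifP;
  rewrite // mulgA tperm2 mul1g.
Qed.

Lemma nc_long_insert m (i : 'I_m) (w : 'S_m) :
  nc_arcs (long_insert i w) <-> nc_arcs w.
Proof.
rewrite /long_insert.
by case: ifP => _; apply: nc_arcs_lift => /=; rewrite ?/bump; lia.
Qed.

Lemma nc_short_insert m (i : 'I_m) (w : 'S_m) :
  nc_arcs (short_insert i w) <-> nc_arcs w.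
Proof.
rewrite /short_insert.
by case: ifP => _; apply: nc_arcs_lift => /=; rewrite ?/bump; lia.
Qed.

Lemma fixed_hi m (i : 'I_m) w : insert_fixed i w (hi i) = lift (lo i) (w i).
Proof. by rewrite -lift_lo_self; apply: lift_perm_lift. Qed.

Lemma descent_lo m (i : 'I_m) w : insert_descent i w (lo i) = lift (lo i) (w i).
Proof. by rewrite insert_descentE permM tpermL fixed_hi. Qed.

Lemma long_insert_descends m (i : 'I_m) (w : 'S_m) :
  (long_insert i w (hi i) < long_insert i w (lo i))%N.
Proof.
rewrite /long_insert; case: ifP => lt_wi.
  by rewrite fixed_hi /insert_fixed lift_perm_id /= /bump; lia.
by rewrite descent_lo /insert_descent lift_perm_id /= /bump; lia.
Qed.

Lemma lift_perm_surj m (g h : 'I_m.+1) (w : 'S_m.+1) :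
  w g = h -> exists w', w = lift_perm g h w'.
Proof.
move=> wg; pose f k := odflt k (unlift h (w (lift g k))).
have fE k : lift h (f k) = w (lift g k).
  rewrite /f; case: unliftP => //= e; move: (neq_lift g k).
  by rewrite -(inj_eq (@perm_inj _ w)) e wg eqxx.
have f_inj : injective f.
  by move=> a b /(congr1 (lift h)); rewrite !fE => /perm_inj/lift_inj.
exists (perm f_inj); apply/permP => x; case: (unliftP g x) => [k|] ->.
  by rewrite lift_perm_lift permE fE.
by rewrite lift_perm_id.
Qed.

(** At the first [p] with [w p < p], everything before [p] is the least element
    of its block.  Either [w p = p - 1], as in [insert_descent], or the arc from
    [p] jumps over [p - 1], whose block, starting at [p - 1], must end before
    [p]: then [p - 1] is a fixed point, as in [insert_fixed]. *)
Lemma nc_arcs_long_insert m (w : 'S_m.+1) :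
  nc_arcs w -> w != 1%g ->
  exists (i : 'I_m) w', w = long_insert i w' /\ nc_arcs w'.
Proof.
move=> nc ne1.
have [p0 lt_p0] : exists p, (w p < p)%N.
  apply/existsP; rewrite -[X in is_true X]negbK negb_exists.
  apply: contra ne1 => /forallP ge_w; apply/eqP/permP => x; rewrite perm1.
  (* if no value lies below its position, [w] fixes the top, then the rest *)
  have [k le_k] := ubnP (m.+1 - x); elim: k x le_k => // k IHk x le_k.
  have := ge_w x; rewrite -leqNgt leq_eqVlt => /orP[/eqP/val_inj<-//|lt_xw].
  by have /perm_inj e : w (w x) = w x by apply: IHk;
    move: (ltn_ord x) (ltn_ord (w x)); lia.
case: (@arg_minnP _ p0 (fun p => (w p < p)%N) val lt_p0) => p lt_p min_p.
have p_gt0 : (0 < p)%N by lia.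
have ltpm : (p.-1 < m)%N by have := ltn_ord p; lia.
pose i := Ordinal ltpm; exists i.
have def_p : p = hi i by apply: val_inj; rewrite /= /bump; lia.
have val_i : i = p.-1 :> nat by [].
clearbody i.
have ge_wlo : (lo i <= w (lo i))%N.
  by rewrite leqNgt; apply/negP => /min_p /=; lia.
suff [w' def_w]: exists w', w = long_insert i w'.
  by exists w'; split=> //; apply/(nc_long_insert i); rewrite -def_w.
have [wp|ne_wp] := eqVneq (w p) (lo i).
  rewrite def_p in wp; have [w' def_w] := lift_perm_surj wp; exists w'.
  rewrite /long_insert ifN //.
  by move: ge_wlo; rewrite def_w -/(insert_descent i w') descent_lo /= /bump;
    lia.
have lt_wp : (w p < lo i)%N.
  by move: ne_wp; rewrite -val_eqE /=; lia.
have wlo : w (lo i) = lo i.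
  apply: val_inj => /=; apply/eqP; rewrite eqn_leq andbC ge_wlo /=.
  have [_ h] := nc (lo i) p; rewrite leqNgt; apply/negP => gt;
    move: h gt lt_wp; rewrite /=; lia.
have [w' def_w] := lift_perm_surj wlo; exists w'.
rewrite /long_insert ifT //.
by move: lt_wp; rewrite def_w -/(insert_fixed i w') def_p fixed_hi /= /bump;
  lia.
Qed.

(** [g] is the inserted position.  Any other length-decreasing transposition
    that involves [g] creates an arc whose interval in [nc_arcs] contains [lo i]
    or [hi i] but not its image. *)
Lemma nc_swap_inserted m (i : 'I_m) (w : 'S_m) (g p q : 'I_m.+1) :
    let v := long_insert i w in
    g = (if (w i < i)%N then lo i else hi i) ->
    (p == g) || (q == g) -> (p < q)%N -> (v q < v p)%N ->
    nc_arcs (tperm p q * v) -> p = lo i /\ q = hi i.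
Proof.
move=> v def_g pqg lt_pq lt_v nc.
have up : (tperm p q * v)%g p = v q by rewrite permM tpermL.
have uq : (tperm p q * v)%g q = v p by rewrite permM tpermR.
have ud x : x != p -> x != q -> (tperm p q * v)%g x = v x.
  by move=> xp xq; rewrite permM tpermD // eq_sym.
have := long_insert_descends i w; rewrite -/v => desc.
have hilo : hi i != lo i by rewrite -val_eqE /= /bump; lia.
case: ifP def_g => lt_wi def_g; rewrite {}def_g in pqg.
  have vlo : v (lo i) = lo i.
    by rewrite /v /long_insert lt_wi /insert_fixed lift_perm_id.
  rewrite vlo in desc; case/orP: pqg => /eqP e;
    rewrite e in up uq ud lt_pq lt_v nc *.
    have [->//|ne] := eqVneq q (hi i); exfalso.
    have uhi : (tperm (lo i) q * v)%g (hi i) = v (hi i).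
      by apply: ud; rewrite // eq_sym.
    have [h _] := nc q (hi i); move: h; rewrite uq uhi.
    by move: ne desc lt_pq; rewrite vlo -val_eqE /= /bump; lia.
  exfalso; have [_ h] := nc p (lo i); move: h; rewrite up uq vlo.
  by rewrite vlo in lt_v; lia.
have vhi : v (hi i) = lo i.
  by rewrite /v /long_insert lt_wi /insert_descent lift_perm_id.
rewrite vhi in desc; case/orP: pqg => /eqP e;
  rewrite e in up uq ud lt_pq lt_v nc *.
  exfalso; have [h _] := nc q (hi i); move: h; rewrite up uq vhi.
  by move: lt_v lt_pq; rewrite vhi /= /bump; lia.
have [->//|ne] := eqVneq p (lo i); exfalso.
have ulo : (tperm p (hi i) * v)%g (lo i) = v (lo i).
  by apply: ud; rewrite eq_sym.
have [_ h] := nc p (lo i); move: h; rewrite up vhi ulo.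
by move: ne desc lt_pq; rewrite -val_eqE /= /bump; lia.
Qed.

(** * Growing a forest inserts a value into its noncrossing partition *)

Definition block_set n (b : seq nat) : {set 'I_n} := [set i | val i \in b].

Lemma backward_cycle_out n (C : {set 'I_n}) (x : 'I_n) :
  x \notin C -> backward_cycle C x = x.
Proof. by move=> xNC; rewrite permE prev_nth mem_enum (negbTE xNC). Qed.

Lemma prod_cycles_notin n (L : seq (seq nat)) (x : 'I_n) :
  val x \notin flatten L ->
  (\prod_(b <- L) backward_cycle (block_set n b))%g x = x.
Proof.
elim: L => [|b L IHL]; first by rewrite big_nil perm1.
rewrite /= mem_cat negb_or => /andP[xNb xNL]; rewrite big_cons permM.
by rewrite backward_cycle_out ?inE ?IHL.
Qed.

Lemma prod_cycles_pred n (L : seq (seq nat)) (b : seq nat) (x : 'I_n) :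
  uniq (flatten L) -> b \in L -> val x \in b ->
  cyclic_pred (block_set n b) x
    ((\prod_(b <- L) backward_cycle (block_set n b))%g x).
Proof.
elim: L => //= b0 L IHL; rewrite cat_uniq => /and3P[_ /hasPn disj uL].
rewrite inE big_cons permM => /predU1P[-> x_b0|bL xb].
  have x_in : x \in block_set n b0 by rewrite inE.
  have st := backward_cycle_pred x_in; rewrite prod_cycles_notin //.
  by apply: contraL (st.1) => /disj; rewrite inE.
have x_L : val x \in flatten L by apply/flattenP; exists b.
by rewrite [backward_cycle _ x]backward_cycle_out ?inE ?disj //; apply: IHL.
Qed.

(** All that matters of the order in which a block is listed is that its head is
    its least element: a leaf is a right child exactly when it is not the head
    of its block, and this decides how growing at the leaf acts. *)
Definition head_min (b : seq nat) : bool :=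
  if b is h :: _ then all (leq h) b else false.

Lemma head_min_cat b1 b2 :
  head_min b1 -> allrel leq b1 b2 -> head_min (b1 ++ b2).
Proof.
case: b1 => //= h b1 /andP[-> hb1] /allrelP le12; rewrite /= all_cat hb1.
by apply/allP => z /(le12 h z); apply; rewrite inE eqxx.
Qed.

Lemma tree_blocks_partition is_right o t :
  let: (b, bs) := tree_blocks is_right o t in
  [/\ perm_eq (b ++ flatten bs) (iota o (leaves t)),
    head_min b & all head_min bs].
Proof.
elim: t is_right o => [|l IHl r IHr] is_right o /=; first by rewrite leqnn.
case: (tree_blocks false o l) (IHl false o) => bl sl [pl hl hsl].
case: (tree_blocks true _ r) (IHr true (o + leaves l)) => br sr [pr hr hsr].
have hall : all head_min (sl ++ sr) by rewrite all_cat hsl.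
have perm : perm_eq ((bl ++ flatten sl) ++ br ++ flatten sr)
                    (iota o (leaves l + leaves r)).
  by rewrite iotaD perm_cat.
case: is_right; split=> //=.
- rewrite flatten_cat; apply: perm_trans perm.
  by rewrite perm_catCA -!catA perm_cat2l perm_catCA.
- by rewrite hl.
- rewrite flatten_cat; apply: perm_trans perm; rewrite -!catA perm_cat2l.
  by rewrite perm_catCA.
apply: head_min_cat hl _; apply/allrelP => x y xl yr.
have : x \in iota o (leaves l) by rewrite -(perm_mem pl) mem_cat xl.
have : y \in iota (o + leaves l) (leaves r).
  by rewrite -(perm_mem pr) mem_cat yr.
by rewrite !mem_iota; lia.
Qed.

Lemma forest_blocks_partition o s :
  perm_eq (flatten (forest_blocks o s)) (iota o (sumn (map leaves s))) /\
  all head_min (forest_blocks o s).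
Proof.
elim: s o => //= t s IHs o.
case: (tree_blocks false o t) (tree_blocks_partition false o t) =>
  b bs [pb hb hbs].
have [ps hs] := IHs (o + leaves t).
by rewrite /= hb all_cat hbs flatten_cat iotaD catA perm_cat.
Qed.

Lemma ForToNC_pred n (F : Forest n) b (x : 'I_n) :
  b \in forest_blocks 0 F -> val x \in b ->
  cyclic_pred (block_set n b) x (ForToNC F x).
Proof.
move=> bF xb; apply: prod_cycles_pred => //.
by rewrite (perm_uniq (forest_blocks_partition 0 F).1) iota_uniq.
Qed.

Lemma forest_blocks_cover n (F : Forest n) (x : 'I_n) :
  exists2 b, b \in forest_blocks 0 F & val x \in b.
Proof.
apply/flattenP; rewrite (perm_mem (forest_blocks_partition 0 F).1) mem_iota.
by rewrite (eqP (valP F)) /=.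
Qed.

(** The effect of splitting leaf [i]: the two new leaves stay together when [i]
    is the head of its block; otherwise only the right one stays, and the left
    one becomes a block of its own. *)
Definition grow_block (i : nat) (b : seq nat) : seq nat :=
  if ohead b == Some i then i :: map (bump i) b else map (bump i) b.

Lemma tree_blocks_shift is_right o t :
  tree_blocks is_right o.+1 t =
  let: (b, bs) := tree_blocks is_right o t in (map S b, map (map S) bs).
Proof.
elim: t is_right o => [|l IHl r IHr] is_right o //=.
rewrite addSn IHl IHr; case: tree_blocks => bl sl; case: tree_blocks => br sr.
by case: is_right; rewrite /= !map_cat.
Qed.

Lemma forest_blocks_shift o s :
  forest_blocks o.+1 s = map (map S) (forest_blocks o s).
Proof.
elim: s o => //= t s IHs o.
by rewrite tree_blocks_shift addSn IHs; case: tree_blocks => b bs;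
  rewrite /= map_cat.
Qed.

Lemma map_bump_right i b :
  {in b, forall z, i <= z}%N -> map (bump i) b = map S b.
Proof. by move=> gt_b; apply/eq_in_map => z /gt_b; rewrite /bump => ->. Qed.

Lemma grow_block_right i b :
  {in b, forall z, i < z}%N -> grow_block i b = map S b.
Proof.
move=> gt_b; rewrite /grow_block map_bump_right => [|z /gt_b/ltnW //].
case: eqP => // e; case: b gt_b e => //= h b /(_ h (mem_head _ _)) lt_ih [e].
by rewrite e ltnn in lt_ih.
Qed.

Lemma map_bump_left i b : {in b, forall z, z < i}%N -> map (bump i) b = b.
Proof.
move=> lt_b; apply: map_id_in => z /lt_b; rewrite /bump; lia.
Qed.

Lemma grow_block_left i b : {in b, forall z, z < i}%N -> grow_block i b = b.
Proof.
move=> lt_b; rewrite /grow_block map_bump_left //.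
case: eqP => // e; case: b lt_b e => //= h b /(_ h (mem_head _ _)) lt_ih [e].
by rewrite e ltnn in lt_ih.
Qed.

Lemma ohead_mem (T : eqType) (s : seq T) x : ohead s = Some x -> x \in s.
Proof. by case: s => //= y s [->]; apply: mem_head. Qed.

Lemma tree_blocks_range is_right o t b z :
  let: (b0, bs) := tree_blocks is_right o t in
  b \in b0 :: bs -> z \in b -> (o <= z < o + leaves t)%N.
Proof.
have := tree_blocks_partition is_right o t.
case: tree_blocks => b0 bs [p _ _] b_in zb; rewrite -mem_iota -(perm_mem p).
by rewrite -[_ ++ _]/(flatten (b0 :: bs)); apply/flattenP; exists b.
Qed.

Lemma leaves_grow_tree t k :
  (k < leaves t)%N -> leaves (grow_tree k t) = (leaves t).+1.
Proof.
elim: t k => //= l IHl r IHr k lt_k.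
case: ltnP => [lt_kl | le_lk] /=; first by rewrite IHl.
by rewrite IHr ?addnS // ltn_subLR.
Qed.

Lemma grow_block_cat i b1 b2 :
  head_min b1 -> grow_block i (b1 ++ b2) = grow_block i b1 ++ map (bump i) b2.
Proof. by case: b1 => // h b1 _; rewrite /grow_block /= map_cat; case: ifP. Qed.

Lemma ohead_cat (b1 b2 : seq nat) :
  head_min b1 -> ohead (b1 ++ b2) = ohead b1.
Proof. by case: b1. Qed.

(** When the root is a right child its block will be appended to another one,
    so that [o + k] cannot be the head of the final block even if it heads the
    block built so far.  That is why the root block is then merely shifted, and
    why its head is not inspected. *)
Lemma tree_blocks_grow is_right o t k :
  (k < leaves t)%N ->
  let: (b, bs) := tree_blocks is_right o t in
  let: (b', bs') := tree_blocks is_right o (grow_tree k t) in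
  b' = (if is_right then map (bump (o + k)) b else grow_block (o + k) b) /\
  {in bs', forall c, (exists2 d, d \in bs & c = grow_block (o + k) d) \/
     c = [:: o + k] /\
     {in (if is_right then bs else b :: bs), forall d,
       ohead d != Some (o + k)}}.
Proof.
elim: t is_right o k => [|l IHl r IHr] is_right o k /=.
  rewrite ltnS leqn0 => /eqP ->; rewrite addn0 addn1.
  case: is_right => /=; rewrite /grow_block /= ?eqxx /bump leqnn; split=> //.
  by move=> c; rewrite inE => /eqP->; right.
move=> lt_k.
have rl b z := tree_blocks_range false o l b z.
have rr b z := tree_blocks_range true (o + leaves l) r b z.
case: (ltnP k (leaves l)) => [lt_kl|le_lk].
  have hl : leaves (grow_tree k l) = (leaves l).+1 by apply: leaves_grow_tree.
  rewrite /= hl addnS tree_blocks_shift.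
  have := tree_blocks_partition false o l; have := IHl false o k lt_kl.
  case: (tree_blocks false o l) rl => bl sl rl.
  case: (tree_blocks false o (grow_tree k l)) => bl' sl' [-> IH] [_ min_l _].
  case: (tree_blocks true _ r) rr => br sr rr.
  have gr d : d \in br :: sr -> {in d, forall z, o + k < z}%N.
    by move=> d_in z /(rr d z d_in); lia.
  have hr d : d \in sr -> ohead d != Some (o + k).
    move=> d_sr; apply/eqP => /ohead_mem; move/gr; rewrite inE d_sr orbT ltnn.
    by move/(_ isT).
  have in_sr c : c \in map (map S) sr ->
      exists2 d, d \in sr & c = grow_block (o + k) d.
    case/mapP=> d d_sr ->; exists d; rewrite ?grow_block_right // => z.
    by apply: gr; rewrite inE d_sr orbT.
  have br_bump : map S br = map (bump (o + k)) br.
    by rewrite map_bump_right // => z zbr; apply/ltnW/(gr br);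
      rewrite ?mem_head.
  case: is_right; rewrite br_bump; split=> //=.
  - move=> c; rewrite inE mem_cat.
    case/or3P=> [/eqP->|/IH[[d d_sl ->]|[-> hd]]|/in_sr[d d_sr ->]].
    + by left; exists bl; rewrite ?mem_head.
    + by left; exists d; rewrite // inE mem_cat d_sl orbT.
    + right; split=> // d; rewrite inE mem_cat orbA => /orP[d_l|/hr//].
      by apply: hd; rewrite inE.
    + by left; exists d; rewrite // inE mem_cat d_sr !orbT.
  - by rewrite grow_block_cat.
  - move=> c; rewrite mem_cat.
    case/orP=> [/IH[[d d_sl ->]|[-> hd]]|/in_sr[d d_sr ->]].
    + by left; exists d; rewrite // mem_cat d_sl.
    + right; split=> // d; rewrite inE mem_cat => /or3P[/eqP->|d_sl|/hr//].
        by rewrite ohead_cat //; apply: hd; rewrite mem_head.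
      by apply: hd; rewrite inE d_sl orbT.
    + by left; exists d; rewrite // mem_cat d_sr orbT.
have lt_kr : (k - leaves l < leaves r)%N by lia.
have def_i : (o + leaves l + (k - leaves l) = o + k)%N by lia.
have := IHr true (o + leaves l)%N _ lt_kr; rewrite def_i /=.
have := tree_blocks_partition false o l.
case: (tree_blocks false o l) rl => bl sl rl [_ min_l _].
case: (tree_blocks true _ r) rr => br sr _.
case: (tree_blocks true _ (grow_tree _ r)) => br' sr' [-> IH].
have gl d : d \in bl :: sl -> {in d, forall z, z < o + k}%N.
  by move=> d_in z /(rl d z d_in); lia.
have hl d : d \in bl :: sl -> ohead d != Some (o + k).
  by move=> d_l; apply/eqP => /ohead_mem/(gl _ d_l); rewrite ltnn.
have in_l c : c \in bl :: sl -> c = grow_block (o + k) c.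
  by move/gl/grow_block_left.
case: is_right; split=> //=.
- move=> c; rewrite inE mem_cat orbA => /orP[c_l|/IH[[d d_sr ->]|[-> hd]]].
  + left; exists c; first by rewrite inE mem_cat orbA c_l.
    by apply: in_l; rewrite inE.
  + by left; exists d; rewrite // inE mem_cat d_sr !orbT.
  + right; split=> // d; rewrite inE mem_cat orbA => /orP[d_l|/hd//].
    by apply: hl; rewrite inE.
- by rewrite grow_block_cat // -in_l ?mem_head.
- move=> c; rewrite mem_cat => /orP[c_sl|/IH[[d d_sr ->]|[-> hd]]].
  + left; exists c; first by rewrite mem_cat c_sl.
    by apply: in_l; rewrite inE c_sl orbT.
  + by left; exists d; rewrite // mem_cat d_sr orbT.
  + right; split=> // d; rewrite inE mem_cat => /or3P[/eqP->|d_sl|/hd//].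
      by rewrite ohead_cat // hl ?mem_head.
    by apply: hl; rewrite inE d_sl orbT.
Qed.

Lemma forest_blocks_grow o s k :
  (k < sumn (map leaves s))%N ->
  {in forest_blocks o (grow_seq k s), forall c,
     (exists2 d, d \in forest_blocks o s & c = grow_block (o + k) d) \/
     c = [:: o + k] /\
     {in forest_blocks o s, forall d, ohead d != Some (o + k)}}.
Proof.
elim: s o k => //= t s IHs o k lt_k.
have rt b z := tree_blocks_range false o t b z.
have rs d z : d \in forest_blocks (o + leaves t) s -> z \in d ->
    (o + leaves t <= z)%N.
  move=> d_in zd; have [p _] := forest_blocks_partition (o + leaves t) s.
  have : z \in flatten (forest_blocks (o + leaves t) s).
    by apply/flattenP; exists d.
  by rewrite (perm_mem p) mem_iota => /andP[].
case: (ltnP k (leaves t)) => [lt_kt|le_tk] /=.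
  rewrite leaves_grow_tree // addnS forest_blocks_shift.
  have := tree_blocks_grow false o lt_kt.
  case: (tree_blocks false o t) => b bs.
  case: (tree_blocks false o _) => b' bs' [-> IH] c.
  have gs d : d \in forest_blocks (o + leaves t) s ->
      {in d, forall z, o + k < z}%N.
    by move=> d_in z /(rs d z d_in); lia.
  rewrite inE mem_cat => /or3P[/eqP->|/IH[[d d_bs ->]|[-> hd]]|/mapP[d d_s ->]].
  - by left; exists b; rewrite ?mem_head.
  - by left; exists d; rewrite // inE mem_cat d_bs orbT.
  - right; split=> // d; rewrite inE mem_cat orbA => /orP[d_t|d_s].
      by apply: hd; rewrite inE.
    by apply/eqP => /ohead_mem/(gs _ d_s); rewrite ltnn.
  - left; exists d; first by rewrite inE mem_cat d_s !orbT.
    by rewrite grow_block_right //; apply: gs.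
have lt_ks : (k - leaves t < sumn (map leaves s))%N by lia.
have def_i : (o + leaves t + (k - leaves t) = o + k)%N by lia.
have IH := IHs (o + leaves t)%N _ lt_ks; rewrite def_i in IH.
case: (tree_blocks false o t) rt => b bs rt c.
have gt d : d \in b :: bs -> {in d, forall z, z < o + k}%N.
  by move=> d_in z /(rt d z d_in); lia.
rewrite inE mem_cat orbA => /orP[c_t|/IH[[d d_s ->]|[-> hd]]].
- left; exists c; first by rewrite inE mem_cat orbA c_t.
  by rewrite grow_block_left //; apply: gt; rewrite inE.
- by left; exists d; rewrite // inE mem_cat d_s !orbT.
right; split=> // d; rewrite inE mem_cat orbA => /orP[d_t|/hd//].
by apply/eqP => /ohead_mem/gt; rewrite inE d_t ltnn => /(_ isT).
Qed.

Lemma forest_block_lt n (F : Forest n) b z :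
  b \in forest_blocks 0 F -> z \in b -> (z < n)%N.
Proof.
move=> bF zb; have : z \in flatten (forest_blocks 0 F).
  by apply/flattenP; exists b.
by rewrite (perm_mem (forest_blocks_partition 0 F).1) mem_iota (eqP (valP F)).
Qed.

(** The head of a block is its least element, the only one that a backward cycle
    does not decrease. *)
Lemma head_iff_ascends n (G : Forest n) b (i : 'I_n) :
  b \in forest_blocks 0 G -> val i \in b ->
  (ohead b == Some (val i)) = (i <= ForToNC G i)%N.
Proof.
move=> bG ib; have [wb st] := ForToNC_pred bG ib.
have /allP/(_ _ bG) := (forest_blocks_partition 0 G).2.
have lt_b z : z \in b -> (z < n)%N := forest_block_lt bG.
case: b {bG} ib wb st lt_b => // h b ib wb st lt_b /= /andP[_ /allP hb].
have h_le z : z \in h :: b -> (h <= z)%N by rewrite inE => /predU1P[->|/hb].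
apply/eqP/idP => [[e]|le_iw].
  by move: wb; rewrite inE => /h_le; rewrite e.
case: st => [[]|bnd]; first by lia.
have lt_h := lt_b h (mem_head _ _).
have := bnd (Ordinal lt_h); rewrite inE mem_head => /(_ isT) /=.
by have := h_le _ ib; move=> h1 /andP[h2 _]; congr Some; apply/eqP;
  rewrite eqn_leq h1.
Qed.

(** By [forest_blocks_grow] each block of the grown forest is a grown block or
    the new singleton.  [head_iff_ascends] matches the two cases of [grow_block]
    with those of [long_insert]. *)
Lemma ForToNC_grow m (G : Forest m) (i : 'I_m) :
  ForToNC (grow G i) = long_insert i (ForToNC G).
Proof.
apply/permP => x; have [c cF xc] := forest_blocks_cover (grow G i) x.
apply: (@cyclic_pred_uniq _ (block_set _ c) x); first by rewrite inE.
  exact: ForToNC_pred.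
have lt_i : (i < sumn (map leaves G))%N by rewrite (eqP (valP G)).
have := forest_blocks_grow (o := 0) lt_i cF; rewrite add0n.
set w := ForToNC G; have cover := forest_blocks_cover G.
case=> [[d dG def_c]|[def_c hd]]; last first.
  have [d dG id] := cover i.
  have lt_wi : (w i < i)%N.
    by rewrite ltnNge -(head_iff_ascends dG id); apply: hd.
  have def_x : x = lo i by apply: val_inj; move: xc; rewrite def_c inE => /eqP.
  rewrite def_x /long_insert lt_wi /insert_fixed lift_perm_id; split;
    first by rewrite inE def_c inE.
  by right=> z; rewrite inE def_c inE => /eqP ->; rewrite leqnn.
have lt_d z : z \in d -> (z < m)%N := forest_block_lt dG.
have bumpP (y : 'I_m.+1) : val y \in map (bump i) d ->
    exists2 z : 'I_m, val z \in d & y = lift (lo i) z.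
  by case/mapP => z zd e; exists (Ordinal (lt_d z zd)) => //; apply: val_inj.
have bump_mem (z : 'I_m) :
    val z \in d -> val (lift (lo i) z) \in map (bump i) d.
  by move=> zd; apply: map_f.
have stepG (z : 'I_m) :
  val z \in d -> cyclic_pred (block_set m d) z (w z) := ForToNC_pred dG.
move: def_c; rewrite /grow_block; case: ifP => [/eqP hd|hd] def_c; last first.
  have [z zd def_x] : exists2 z : 'I_m, val z \in d & x = lift (lo i) z.
    by apply: bumpP; rewrite -def_c.
  have -> : long_insert i w x = lift (lo i) (w z).
    rewrite def_x /long_insert; case: ifP => [_|ge_wi];
      first exact: lift_perm_lift.
    rewrite -lift_hi_lo ?lift_perm_lift //; apply: contraFneq hd => e.
    by rewrite (head_iff_ascends dG) -?e // e leqNgt ge_wi.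
  have [wd st] := stepG z zd; rewrite inE in wd.
  split; first by rewrite inE def_c bump_mem.
  rewrite def_x; case: st => [[lt_wz nb]|bnd]; [left; split|right].
  - by rewrite /= /bump; lia.
  - move=> y; rewrite inE def_c => /bumpP[y' y'd ->].
    by have := nb y'; rewrite inE y'd => /(_ isT); rewrite /= /bump; lia.
  - move=> y; rewrite inE def_c => /bumpP[y' y'd ->].
    by have := bnd y'; rewrite inE y'd => /(_ isT); rewrite /= /bump; lia.
have id := ohead_mem hd.
have ge_wi : (i <= w i)%N by rewrite -(head_iff_ascends dG) ?hd.
have memc (y : 'I_m.+1) :
    (val y \in c) = (y == lo i) || (val y \in map (bump i) d).
  by rewrite def_c inE -val_eqE.
have bnd (z : 'I_m) : val z \in d -> (i <= z <= w i)%N.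
  move=> zd; have [_ [[]|]] := stepG i id; first by lia.
  by apply; rewrite inE.
rewrite /long_insert ltnNge ge_wi /=.
move: xc; rewrite memc => /predU1P[->|/bumpP[z zd def_x]].
  rewrite descent_lo; have [wd _] := stepG i id; rewrite inE in wd.
  split; first by rewrite inE memc bump_mem ?orbT.
  right=> y; rewrite inE memc => /predU1P[->|/bumpP[y' /bnd y'd ->]];
    rewrite /= /bump; lia.
have [ez|nez] := eqVneq z i.
  have {def_x} -> : x = hi i by rewrite def_x ez lift_lo_self.
  rewrite /insert_descent lift_perm_id; split; first by rewrite inE memc eqxx.
  left; split=> [|y _]; rewrite /= /bump; lia.
rewrite def_x -{2}lift_hi_lo // lift_perm_lift.
have [wd st] := stepG z zd; rewrite inE in wd.
split; first by rewrite inE memc bump_mem ?orbT.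
case: st => [[lt_wz nb]|bnd']; last first.
  have := bnd' i; rewrite inE id => /(_ isT).
  by have := bnd z zd; move: nez; rewrite -val_eqE /=; lia.
left; split=> [|y]; first by rewrite /= /bump; lia.
have := bnd _ wd; rewrite inE memc => bw /predU1P[->|/bumpP[y' y'd ->]].
  by rewrite /= /bump; lia.
by have := nb y'; rewrite inE y'd => /(_ isT); rewrite /= /bump; lia.
Qed.

Lemma ForToNC_empty n : ForToNC (empty_forest n) = 1%g.
Proof.
apply/permP => x; rewrite perm1.
have [b bF xb] := forest_blocks_cover (empty_forest n) x.
have sz_b : forall k o,
    b \in forest_blocks o (nseq k Leaf) -> exists y, b = [:: y].
  elim=> //= k IHk o; rewrite inE => /predU1P[->|/IHk//]; by exists o.
have [y def_b] := sz_b _ _ bF.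
have [+ _] := ForToNC_pred bF xb; move: xb;
  rewrite inE def_b !inE => /eqP <- /eqP e.
exact: val_inj.
Qed.

Lemma tree_is_grown t :
  t <> Leaf -> exists t' k, (k < leaves t')%N /\ t = grow_tree k t'.
Proof.
elim: t => // l IHl r IHr _.
case: l IHl => [_|l1 l2 IHl]; last first.
  have [//|l' [k [lt_k ->]]] := IHl; exists (Node l' r), k.
  by rewrite /= lt_k ltn_addr.
case: r IHr => [_|r1 r2 IHr]; first by exists Leaf, 0.
have [//|r' [k [lt_k ->]]] := IHr; exists (Node Leaf r'), k.+1.
by rewrite /= ltnS subSS subn0.
Qed.

Lemma forest_is_grown s :
  s <> nseq (sumn (map leaves s)) Leaf ->
  exists s' k, (k < sumn (map leaves s'))%N /\ s = grow_seq k s'.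
Proof.
elim: s => // t s IHs; case: t => [|l r] ne_s.
  case: IHs => [e|s' [k [lt_k def_s]]]; first by apply: ne_s; rewrite /= {1}e.
  by exists (Leaf :: s'), k.+1; rewrite /= ltnS subSS subn0 def_s.
have [//|t' [k [lt_k ->]]] := @tree_is_grown (Node l r).
by exists (t' :: s), k; rewrite /= lt_k ltn_addr.
Qed.

Lemma nonempty_is_grown m (F : Forest m.+1) :
  F != empty_forest m.+1 -> exists (G : Forest m) i, F = grow G i.
Proof.
move=> neF; case: (@forest_is_grown F) => [e|s [k [lt_k def_F]]].
  case/eqP: neF; by apply: val_inj; rewrite [LHS]e (eqP (valP F)).
have sum_s : sumn (map leaves s) == m.
  have /eqP :=
    grow_subproof (MkForest (eqxx (sumn (map leaves s)))) (Ordinal lt_k).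
  by move: (valP F); rewrite /= def_F /= => /eqP -> [->].
have lt_km : (k < m)%N by rewrite -(eqP sum_s).
by exists (MkForest sum_s), (Ordinal lt_km); apply: val_inj.
Qed.

Lemma ForToNC_surj n (w : 'S_n) :
  nc_arcs w -> exists F : Forest n, ForToNC F = w.
Proof.
elim: n w => [|m IHm] w nc.
  by exists (empty_forest 0); apply/permP => -[].
have [->|ne1] := eqVneq w 1%g.
  by exists (empty_forest m.+1); rewrite ForToNC_empty.
have [i [w' [-> nc']]] := nc_arcs_long_insert nc ne1.
by have [G <-] := IHm w' nc'; exists (grow G i); rewrite ForToNC_grow.
Qed.

(** * Bruhat order *)

Lemma tperm_mulC n (p q : 'I_n) (w : 'S_n) :
  (tperm p q * w = w * tperm (w p) (w q))%g.
Proof. by rewrite conjgC tpermJ. Qed.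

(** Applying the transposition s to both positions of an inversion of w gives an
    inversion of [s * w], unless this reverses the two positions.  In that case
    the pair itself is still an inversion.  The resulting map is injective and
    misses the pair (p, q), which is an inversion of [s * w]. *)
Lemma perm_length_swap n (p q : 'I_n) (w : 'S_n) :
  (p < q)%N -> (w p < w q)%N ->
  (perm_length w < perm_length (tperm p q * w)%g)%N.
Proof.
move=> lt_pq lt_w; set s := tperm p q; pose w' := (s * w)%g.
have w'E x : w' x = w (s x) by rewrite permM.
pose phi (xy : 'I_n * 'I_n) :=
  if (s xy.1 < s xy.2)%N then (s xy.1, s xy.2) else xy.
have sp : s p = q by rewrite /s tpermL.
have sq : s q = p by rewrite /s tpermR.
have sK x : s (s x) = x by rewrite /s tpermK.
have sd x : x != p -> x != q -> s x = x.
  by move=> *; rewrite /s tpermD // eq_sym.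
rewrite /perm_length.
set I := [set _ | _]; set I' := [set _ | _].
have kept x y : (x, y) \in I -> ~~ (s x < s y)%N ->
    x = p /\ (p < y < q)%N \/ y = q /\ (p < x < q)%N.
  rewrite inE /= => /andP[lt_xy lt_wyx].
  have [exp|xp] := eqVneq x p.
    have [eyq|yq] := eqVneq y q; first by move: lt_wyx; rewrite exp eyq; lia.
    have yp : y != p by rewrite -val_eqE /=; rewrite exp in lt_xy; lia.
    rewrite exp sp (sd y) // => le_yq; left; split=> //; move: yq.
    by rewrite exp in lt_xy; rewrite -val_eqE /=; lia.
  have [exq|xq] := eqVneq x q.
    rewrite exq in lt_xy *; rewrite sq (sd y); rewrite -?val_eqE /=; lia.
  rewrite (sd x) //; have [eyq|yq] := eqVneq y q.
    rewrite eyq sq => le_px; right; split=> //; move: xp.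
    by rewrite eyq in lt_xy; rewrite -val_eqE /=; lia.
  have [eyp|yp] := eqVneq y p; last by rewrite sd // lt_xy.
  by rewrite eyp in lt_xy *; rewrite sp; lia.
have phiI xy : xy \in I -> phi xy \in I' :\ (p, q).
  case: xy => x y xyI; have := xyI; rewrite inE /= => /andP[lt_xy lt_wyx].
  rewrite !inE /phi /=; case: ifPn => [lt_s|/(kept _ _ xyI)] /=.
    rewrite -/s -/w' !w'E !sK lt_s lt_wyx !andbT xpair_eqE.
    apply/negP => /andP[/eqP ex /eqP ey].
    by have := lt_xy; rewrite -(sK x) -(sK y) ex ey sp sq; lia.
  rewrite -/w' !w'E lt_xy /= xpair_eqE -!val_eqE /=.
  case=> [[ex lt_y]|[ey lt_x]].
    have -> : s y = y by apply: sd; rewrite -val_eqE /=; lia.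
    by rewrite ex in lt_wyx *; rewrite sp; lia.
  have -> : s x = x by apply: sd; rewrite -val_eqE /=; lia.
  by rewrite ey in lt_wyx *; rewrite sq; lia.
have mixed x y x' y' : (x, y) \in I -> (x', y') \in I -> ~~ (s x' < s y')%N ->
    (s x, s y) != (x', y').
  move=> xyI xyI' /(kept _ _ xyI') cs; apply/eqP => -[ex ey].
  have : (x < y)%N by move: xyI; rewrite inE => /andP[].
  rewrite -(sK x) -(sK y) ex ey; case: cs => [[-> lt_y]|[-> lt_x]].
    by rewrite sp (sd y'); rewrite -?val_eqE /=; lia.
  by rewrite sq (sd x'); rewrite -?val_eqE /=; lia.
have phi_inj : {in I &, injective phi}.
  move=> [x y] [x' y'] xyI xyI'; rewrite /phi /=; case: ifPn => h;
    case: ifPn => h'.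
  - by case=> /perm_inj-> /perm_inj->.
  - by move/eqP; rewrite (negbTE (mixed _ _ _ _ xyI xyI' h')).
  - by move/eqP; rewrite eq_sym (negbTE (mixed _ _ _ _ xyI' xyI h)).
  - by [].
rewrite -(card_in_imset phi_inj).
have pqI' : (p, q) \in I' by rewrite inE /= -/w' !w'E sp sq lt_pq.
rewrite [X in (_ < X)%N](cardsD1 (p, q)) pqI' ltnS subset_leq_card //.
by apply/subsetP => _ /imsetP[xy /phiI ? ->].
Qed.

(** Steps in terms of positions, which insertions carry along. *)
Lemma bruhat_stepP n (u v : 'S_n) :
  bruhat_step u v <->
  exists p q : 'I_n, [/\ (p < q)%N, (u p < u q)%N & v = (tperm p q * u)%g].
Proof.
split=> [|[p [q [lt_pq lt_u def_v]]]]; last first.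
  rewrite /bruhat_step def_v perm_length_swap // andbT.
  by apply/existsP; exists (u p); apply/existsP; exists (u q);
    rewrite tperm_mulC.
case/andP=> /existsP[a /existsP[b /eqP def_v]] lt_uv.
have {}def_v : v = (tperm (u^-1 a) (u^-1 b) * u)%g.
  by rewrite tperm_mulC !permKV.
have ex (p q : 'I_n) : (p < q)%N -> v = (tperm p q * u)%g ->
    [/\ (p < q)%N, (u p < u q)%N & v = (tperm p q * u)%g].
  move=> lt_pq e; split=> //; rewrite ltnNge leq_eqVlt;
    apply/negP => /orP[/eqP/val_inj/perm_inj e'|lt_u].
    by rewrite e' ltnn in lt_pq.
  have : (perm_length v < perm_length (tperm p q * v)%g)%N.
    by apply: perm_length_swap => //; rewrite e !permM tpermL tpermR.
  by rewrite {2}e mulgA tperm2 mul1g; lia.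
case: (ltngtP (u^-1 a)%g (u^-1 b)%g) => [lt|lt|/val_inj e].
- by exists (u^-1 a)%g, (u^-1 b)%g; apply: ex.
- by exists (u^-1 b)%g, (u^-1 a)%g; apply: ex; rewrite // tpermC.
by rewrite def_v e tperm1 mul1g ltnn in lt_uv.
Qed.

Lemma bruhat_length n (u v : 'S_n) :
  bruhat u v -> (perm_length u <= perm_length v)%N.
Proof.
case/connectP=> s + ->; elim: s u => //= x s IHs u /andP[/andP[_ lt_ux] /IHs].
exact/leq_trans/ltnW.
Qed.

Lemma bruhat_homo n m (f : 'S_n -> 'S_m) :
  (forall u v, bruhat_step u v -> bruhat (f u) (f v)) ->
  forall u v, bruhat u v -> bruhat (f u) (f v).
Proof.
move=> f_step u v /connectP[s + ->]; elim: s u => [|x s IHs] u /=;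
  first by rewrite /bruhat connect0.
by case/andP=> /f_step ux /IHs; apply: connect_trans.
Qed.

Lemma lift_perm_tperm n (g : 'I_n.+1) (p q : 'I_n) :
  lift_perm g g (tperm p q) = tperm (lift g p) (lift g q).
Proof.
apply/permP => x; case: (unliftP g x) => [k|] ->.
  by rewrite lift_perm_lift inj_tperm //; apply: lift_inj.
by rewrite lift_perm_id tpermD // eq_sym neq_lift.
Qed.

Lemma lift_perm_swap n (g h : 'I_n.+1) (p q : 'I_n) (w : 'S_n) :
  lift_perm g h (tperm p q * w)%g =
  (tperm (lift g p) (lift g q) * lift_perm g h w)%g.
Proof. by rewrite -lift_perm_tperm lift_permM. Qed.

Lemma bruhat_lift_perm n (g h : 'I_n.+1) (u v : 'S_n) :
  bruhat u v -> bruhat (lift_perm g h u) (lift_perm g h v).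
Proof.
apply: bruhat_homo => {}u {}v /bruhat_stepP[p [q [lt_pq lt_u ->]]].
apply/connect1/bruhat_stepP; exists (lift g p), (lift g q).
rewrite lift_perm_swap !lift_perm_lift; split=> //=; rewrite /bump; lia.
Qed.

(** For adjacent [a] and [b] this is the Demazure product with the simple
    reflection that exchanges them. *)
Definition longer_swap n (a b : 'I_n) (w : 'S_n) : 'S_n :=
  if (w b < w a)%N then w else (tperm a b * w)%g.

(** The lifting property.  The only pair of positions whose order an adjacent
    transposition reverses is the pair it exchanges; every other step from [u]
    to [v] is still a step after transposing both. *)
Lemma bruhat_longer_swap n (a b : 'I_n) (u v : 'S_n) :
  b = a.+1 :> nat -> bruhat u v ->
  bruhat (longer_swap a b u) (longer_swap a b v).
Proof.
move=> ab.
have lt_ab : (a < b)%N by rewrite ab.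
have asc (w : 'S_n) : ~~ (w b < w a)%N -> (w a < w b)%N.
  move=> ge; have : w a != w b by rewrite (inj_eq perm_inj) -val_eqE /=; lia.
  by rewrite -val_eqE /=; lia.
have le_longer w : bruhat w (longer_swap a b w).
  rewrite /longer_swap; case: ifPn => [_|/asc lt_w]; first exact: connect0.
  by apply/connect1/bruhat_stepP; exists a, b.
have le_longer' w : bruhat (tperm a b * w)%g (longer_swap a b w).
  rewrite /longer_swap; case: ifPn => [lt_w|_]; last exact: connect0.
  apply/connect1/bruhat_stepP; exists a, b.
  by rewrite mulgA tperm2 mul1g !permM tpermL tpermR; split.
apply: bruhat_homo => {}u {}v uv.
rewrite {1}/longer_swap; case: ifPn => [_|/asc lt_u].
  exact: connect_trans (connect1 uv) (le_longer v).
case/bruhat_stepP: uv => p [q [lt_pq lt_u' def_v]].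
have [/andP[/eqP ep /eqP eq]|ne_pq] := boolP ((p == a) && (q == b)).
  by rewrite ep eq in def_v; rewrite -def_v; apply: le_longer.
apply: connect_trans (le_longer' v); apply/connect1/bruhat_stepP.
exists (tperm a b p), (tperm a b q); split.
- have ne : ~~ ((p == a :> nat) && (q == b :> nat)) by [].
  have tE (z : 'I_n) : tperm a b z =
      (if z == a :> nat then b else if z == b :> nat then a else z) :> nat.
    by rewrite /tperm permE /= -!val_eqE /=; case: ifP => // _; case: ifP.
  rewrite !tE; move: ne.
  case: (nat_of_ord p =P a) => ?; case: (nat_of_ord p =P b) => ?;
    case: (nat_of_ord q =P a) => ?; case: (nat_of_ord q =P b) => ? /=; lia.
- by rewrite !permM !tpermK.
rewrite -tpermJ def_v !mulgA; congr (_ * u)%g.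
by rewrite conjgE tpermV -!mulgA tperm2 mulg1.
Qed.

Lemma bruhat_long_insert m (i : 'I_m) (u v : 'S_m) :
  bruhat u v -> bruhat (long_insert i u) (long_insert i v).
Proof.
have longE w : long_insert i w = longer_swap (lo i) (hi i) (insert_fixed i w).
  rewrite /longer_swap /long_insert fixed_hi {2}/insert_fixed lift_perm_id.
  by rewrite -insert_descentE /= /bump; congr (if _ then _ else _); lia.
rewrite !longE => uv; apply: bruhat_longer_swap; last exact: bruhat_lift_perm.
by rewrite /= /bump.
Qed.

Lemma short_long_step m (i : 'I_m) (w : 'S_m) :
  bruhat_step (short_insert i w) (long_insert i w).
Proof.
apply/bruhat_stepP; exists (lo i), (hi i); rewrite -long_insertE; split=> //.
have := long_insert_descends i w.
by rewrite long_insertE !permM tpermL tpermR.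
Qed.

(** * Evaluating polynomials at permutations *)

Import GRing.Theory.
Local Open Scope ring_scope.

Lemma mpoly_sub_ind (R : comNzRingType) n (D : {mpoly R[n]} -> Prop) :
  (forall c, D c%:MP) -> (forall i, D 'X_i) ->
  (forall p q, D p -> D q -> D (p + q)) ->
  (forall p q, D p -> D q -> D (p * q)) ->
  forall p, D p.
Proof.
move=> DC DX DD DM p; elim/mpolyind: p => [|a mm p _ _ Dp].
  by rewrite -mpolyC0; apply: DC.
apply: (DD) Dp; rewrite -mul_mpolyC; apply: (DM) => //.
rewrite mpolyXE_id; apply: big_ind => [||j _]; first by rewrite -mpolyC1.
  exact: DM.
by elim: (mm j) => [|k IHk]; rewrite ?expr0 -?mpolyC1 // exprS; apply: DM.
Qed.

Lemma meval_congr (R : comNzRingType) n (d : R) (v1 v2 : 'I_n -> R)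
    (p : {mpoly R[n]}) :
  (forall k, exists r, v1 k - v2 k = r * d) ->
  exists r, p.@[v1] - p.@[v2] = r * d.
Proof.
move=> v12; elim/mpoly_sub_ind: p => [c|i|p q [r er] [s es]|p q [r er] [s es]].
- by exists 0; rewrite !mevalC subrr mul0r.
- by rewrite !mevalXU.
- by exists (r + s); rewrite !mevalD mulrDl opprD addrACA er es.
exists (p.@[v1] * s + r * q.@[v2]);
  rewrite !mevalM mulrDl -(mulrA _ s) -es (mulrAC r) -er.
by rewrite mulrBr mulrBl addrA subrK.
Qed.

Lemma graph_cohomology_ev n (f : 'Ztx[n, n]) :
  @graph_cohomology n (cayley_NC n) (fun w : NC n => ev (val w) f).
Proof.
move=> u w /= /existsP[p0 uw]; rewrite /cayley_label.
case: pickP => [[a b] /andP[/= _ /eqP def_w]|/(_ p0)]; last by rewrite uw.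
apply: meval_congr => k; rewrite def_w permM.
case: tpermP => [->|->|_ _].
- by exists 1; rewrite mul1r.
- by exists (-1); rewrite mulN1r opprB.
by exists 0; rewrite subrr mul0r.
Qed.

(** The substitution that [skip_t] applies to the coefficients. *)
Definition skip m (h : 'I_m.+1) (p : 'Zt[m]) : 'Zt[m.+1] :=
  p \mPo [tuple 'X_(lift h j) | j < m].

Lemma skipX m (h : 'I_m.+1) j : skip h 'X_j = 'X_(lift h j).
Proof. by rewrite /skip comp_mpolyXU -tnth_nth tnth_mktuple. Qed.

Lemma ev_skip_t m (h : 'I_m.+1) (w : 'S_m) (f : 'Ztx[m, m]) :
  (skip_t h f).@[fun k => 'X_(lift h (w k))] = skip h (ev w f).
Proof.
pose lq := [tuple 'X_(lift h j) : 'Zt[m.+1] | j < m].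
rewrite -[skip_t h f]/(map_mpoly (comp_mpoly lq) f).
rewrite -[skip h _]/(comp_mpoly lq _) /ev.
elim/mpoly_sub_ind: f => [c|i|p q ep eq|p q ep eq].
- by rewrite map_mpolyC !mevalC.
- by rewrite map_mpolyX !mevalXU -[RHS]/(skip h _) skipX.
- rewrite [map_mpoly _ _]raddfD; apply: etrans (mevalD _ _ _) _.
  apply: etrans (congr2 +%R ep eq) _.
  by rewrite -[LHS]raddfD; congr (comp_mpoly lq _); rewrite mevalD.
rewrite [map_mpoly _ _]rmorphM; apply: etrans (mevalM _ _ _) _.
apply: etrans (congr2 *%R ep eq) _.
by rewrite -[LHS]rmorphM; congr (comp_mpoly lq _); rewrite mevalM.
Qed.

Lemma meval_insert_at m (g h : 'I_m.+1) (w : 'S_m) (f : 'Ztx[m.+1, m.+1]) :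
  (insert_at g 'X_h f).@[fun k => 'X_(lift h (w k))] = ev (lift_perm g h w) f.
Proof.
rewrite comp_mpoly_meval; apply: meval_eq => j; rewrite tnth_mktuple.
case: unliftP => [k|] ->; first by rewrite mevalXU lift_perm_lift.
by rewrite mevalC lift_perm_id.
Qed.

(** This is the equation defining [E i], read at the point given by [w] with
    [t_i] left out: putting [t_i] back at the two adjacent places yields the two
    insertions.  The sign is the same in both cases of [long_insert], because
    passing from one to the other exchanges the two insertions and also the two
    variables. *)
Lemma ev_long_insert m (i : 'I_m) (w : 'S_m) (f : 'Ztx[m.+1, m.+1]) :
  let v := long_insert i w in
  ev v f = ev (short_insert i w) f +
    ('X_(v (lo i)) - 'X_(v (hi i))) *
    (E i f).@[fun k => 'X_(lift (lo i) (w k))].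
Proof.
pose x k : 'Zt[m.+1] := 'X_(lift (lo i) (w k)) => v.
have eqE : (E i f).@[x] * ('X_(lift (lo i) (w i)) - 'X_(lo i)) =
    ev (insert_descent i w) f - ev (insert_fixed i w) f.
  have den : (E_den i).@[x] = 'X_(lift (lo i) (w i)) - 'X_(lo i).
    apply: etrans (mevalB _ _ _) _.
    by apply: congr2 (mevalXU _ _) (congr1 -%R (mevalC _ _)).
  rewrite -den; apply: etrans (esym (mevalM _ _ _)) _.
  apply: etrans (congr1 (meval x) (E_spec i f)) _.
  apply: etrans (mevalB _ _ _) _.
  by apply: congr2; [|congr (- _)]; apply: meval_insert_at.
move: eqE; rewrite /v /long_insert /short_insert.
case: ifP => _ eqE.
  rewrite fixed_hi [insert_fixed i w (lo i)]lift_perm_id.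
  by rewrite -opprB mulNr mulrC eqE opprB addrC subrK.
rewrite descent_lo [insert_descent i w (hi i)]lift_perm_id mulrC eqE.
by rewrite addrC subrK.
Qed.

Lemma ev1 n (f : 'Ztx[n, n]) : ev 1 f = f.@[fun k => 'X_k].
Proof. by apply: meval_eq => k; rewrite perm1. Qed.

(** * Vanishing of double forest polynomials *)

Lemma ev_forest_long_insert (P : forall n : nat, Forest n -> 'Ztx[n, n])
    (hP : double_forest_polynomials P) m (F : Forest m.+1)
    (i : 'I_m) (w : 'S_m) :
  (exists2 G, F = grow G i & ev (long_insert i w) (P _ F) =
     ev (short_insert i w) (P _ F) +
     ('X_(long_insert i w (lo i)) - 'X_(long_insert i w (hi i))) *
     skip (lo i) (ev w (P _ G)))
  \/ ev (long_insert i w) (P _ F) = ev (short_insert i w) (P _ F).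
Proof.
have [_ _ grown notgrown] := hP _ F.
rewrite ev_long_insert.
have [/existsP[G /eqP def_F]|noG] := boolP [exists G, F == grow G i].
  by left; exists G; rewrite // (grown _ _ def_F) ev_skip_t.
right; rewrite notgrown ?meval0 ?mulr0 ?addr0 // => G def_F.
by case/existsP: noG; exists G; apply/eqP.
Qed.

(** The induction stays among noncrossing partitions, because an insertion is
    noncrossing exactly when the smaller permutation is. *)
Lemma forest_vanishing (P : forall n : nat, Forest n -> 'Ztx[n, n])
    (hP : double_forest_polynomials P) n (F : Forest n) (w : 'S_n) :
  (0 < n)%N -> nc_arcs w -> ev w (P _ F) != 0 -> bruhat (ForToNC F) w.
Proof.
elim: n F w => // m IHm F w _.
have [k] := ubnP (perm_length w); elim: k w => // k IHk w le_k nc.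
have [->|ne1] := eqVneq w 1%g.
  have [_ evP _ _] := hP _ F; rewrite ev1 evP.
  have [->|_] := eqVneq F (empty_forest m.+1); last by rewrite eqxx.
  by rewrite ForToNC_empty /bruhat connect0.
have [i [w' [def_w nc']]] := nc_arcs_long_insert nc ne1;
  rewrite {}def_w in le_k nc ne1 *.
have step := short_long_step i w'; have /andP[_ lt_len] := step.
have nc_short : nc_arcs (short_insert i w') by apply/nc_short_insert.
have [ev0|ev_short] := eqVneq (ev (short_insert i w') (P _ F)) 0; last first.
  move=> _; apply: connect_trans (connect1 step); apply: IHk => //.
  exact: leq_trans lt_len le_k.
have [[G def_F ->]|->] := ev_forest_long_insert hP F i w';
  last by rewrite ev0 eqxx.
rewrite ev0 add0r def_F ForToNC_grow => ne0.
apply/bruhat_long_insert/IHm => //; first exact: leq_ltn_trans (ltn_ord i).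
by apply: contra_neq ne0 => ->; rewrite /skip comp_mpoly0 mulr0.
Qed.

(** * Diagonal values of double forest polynomials *)

(** The Cayley neighbours below [v], indexed by the positions to transpose. *)
Definition nc_descent n (v : 'S_n) (p q : 'I_n) : bool :=
  [&& (p < q)%N, (v q < v p)%N & is_NC (tperm p q * v)%g].

Definition descent_product n (v : 'S_n) : 'Zt[n] :=
  \prod_p \prod_(q | nc_descent v p q) ('X_(v p) - 'X_(v q)).

Lemma nc_descent_lift m (g h : 'I_m.+1) (w : 'S_m) (p q : 'I_m) :
  (h <= g <= h.+1)%N ->
  nc_descent (lift_perm g h w) (lift g p) (lift g q) = nc_descent w p q.
Proof.
move=> gh; rewrite /nc_descent -lift_perm_swap !lift_perm_lift;
  congr [&& _, _ & _].
- by rewrite /= /bump; lia.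
- by rewrite /= /bump; lia.
by apply/idP/idP => /is_NCP/(nc_arcs_lift _ gh)/is_NCP.
Qed.

Lemma skip_prod m (h : 'I_m.+1) (I : finType) (Q : pred I) (F : I -> 'Zt[m]) :
  skip h (\prod_(i | Q i) F i) = \prod_(i | Q i) skip h (F i).
Proof. exact: (rmorph_prod (comp_mpoly _)). Qed.

(** The pairs that involve the inserted position contribute the single factor of
    the short insertion; all other pairs come from [w]. *)
Lemma descent_product_long_insert m (i : 'I_m) (w : 'S_m) :
  nc_arcs w ->
  let v := long_insert i w in
  descent_product v =
    ('X_(v (lo i)) - 'X_(v (hi i))) * skip (lo i) (descent_product w).
Proof.
move=> nc v.
pose F p q : 'Zt[m.+1] := if nc_descent v p q then 'X_(v p) - 'X_(v q) else 1.
have -> : descent_product v = \prod_p \prod_q F p q.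
  by apply: eq_bigr => p _; rewrite big_mkcond.
pose g := if (w i < i)%N then lo i else hi i.
have def_v : v = lift_perm g (lo i) w by rewrite /v /long_insert /g; case: ifP.
have g_lohi : (lo i <= g <= (lo i).+1)%N.
  by rewrite /g; case: ifP; rewrite /= /bump; lia.
have F_lift p q : F (lift g p) (lift g q) =
    skip (lo i) (if nc_descent w p q then 'X_(w p) - 'X_(w q) else 1).
  rewrite /F {1}def_v nc_descent_lift //; case: ifP => _;
    last by rewrite /skip comp_mpoly1.
  by rewrite def_v !lift_perm_lift /skip comp_mpolyB -!/(skip _ _) !skipX.
have F_other p q : (p == g) || (q == g) -> (p, q) != (lo i, hi i) -> F p q = 1.
  move=> pqg ne; rewrite /F ifN //;
    apply: contra ne => /and3P[lt_pq lt_v /is_NCP nc_pq].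
  by have [-> ->] := nc_swap_inserted (erefl g) pqg lt_pq lt_v nc_pq.
have F_lohi : F (lo i) (hi i) = 'X_(v (lo i)) - 'X_(v (hi i)).
  rewrite /F ifT // /nc_descent long_insert_descends andTb /=.
  apply/andP; split; first by rewrite /= /bump; lia.
  by apply/is_NCP; rewrite /v long_insertE mulgA tperm2 mul1g;
    apply/nc_short_insert.
have -> : skip (lo i) (descent_product w) =
    \prod_p \prod_q F (lift g p) (lift g q).
  rewrite skip_prod; apply: eq_bigr => p _; rewrite skip_prod big_mkcond.
  apply: eq_bigr => q _; rewrite F_lift; case: ifP => // _.
  by rewrite /skip comp_mpoly1.
rewrite -F_lohi (bigD1_ord g) //=.
under [X in _ * X]eq_bigr => p _ do rewrite (bigD1_ord g) //=.
rewrite big_split /= mulrA; congr (_ * _).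
have [lt_wi|ge_wi] := boolP (w i < i)%N.
  have def_g : g = lo i by rewrite /g lt_wi.
  rewrite (bigD1 (hi i)) //= def_g !big1 ?mulr1 // => [p _|q ne].
    apply: F_other; rewrite ?def_g ?eqxx ?orbT // xpair_eqE negb_and orbC.
    by rewrite -val_eqE /= /bump; lia.
  by apply: F_other; rewrite ?def_g ?eqxx // xpair_eqE eqxx.
have def_g : g = hi i by rewrite /g (negbTE ge_wi).
have lift_i := lift_hi_self i.
rewrite big1 => [|q _]; last first.
  apply: F_other; rewrite ?def_g ?eqxx // xpair_eqE negb_and.
  by rewrite -val_eqE /= /bump; lia.
rewrite mul1r def_g (bigD1 i) //= lift_i big1 ?mulr1 // => p ne.
apply: F_other; rewrite ?def_g ?eqxx ?orbT // xpair_eqE negb_and -lift_i.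
by rewrite (inj_eq lift_inj) ne.
Qed.

Lemma tperm_lt_inj n (p q p' q' : 'I_n) :
  (p < q)%N -> (p' < q')%N -> tperm p q = tperm p' q' -> (p', q') = (p, q).
Proof.
move=> lt_pq lt_pq' e; have := tpermL p' q'; rewrite -e.
case: tpermP => [-> -> //|ep eq|_ _ eq]; rewrite -eq ?ep in lt_pq'; lia.
Qed.

(** Transposing two positions is transposing two values, and the edge is
    labelled by those values; among the two orders of the positions the Bruhat
    condition selects the descent. *)
Lemma lower_labels_product n (v : NC n) :
  \prod_(u : cayley_NC n | edge u v && NC_bruhat u v) label u v =
  descent_product (val v).
Proof.
pose C (u : NC n) (pq : 'I_n * 'I_n) :=
  [&& (pq.1 < pq.2)%N, (val v pq.2 < val v pq.1)%N
    & val u == (tperm pq.1 pq.2 * val v)%g].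
pose F (pq : 'I_n * 'I_n) : 'Zt[n] := 'X_(val v pq.1) - 'X_(val v pq.2).
have labelE (u : cayley_NC n) : edge u v && NC_bruhat u v ->
    label u v = \prod_(pq | C u pq) F pq.
  case/andP=> /existsP[ab0 uv0]; rewrite /NC_bruhat => /bruhat_length le_uv.
  rewrite /= /cayley_label; case: pickP => [[a b] uv|/(_ ab0)];
    last by rewrite uv0.
  have /andP[/= lt_ab /eqP def_u] : differ_by v u (a, b).
    by rewrite differ_by_sym.
  pose p := ((val v)^-1 b)%g; pose q := ((val v)^-1 a)%g.
  have vp : val v p = b by rewrite /p permKV.
  have vq : val v q = a by rewrite /q permKV.
  have {}def_u : val u = (tperm p q * val v)%g.
    by rewrite tperm_mulC vp vq tpermC.
  have lt_pq : (p < q)%N.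
    rewrite ltnNge leq_eqVlt; apply/negP => /orP[/eqP/val_inj e|lt_qp].
      by move: lt_ab; rewrite -vp -vq e ltnn.
    have := @perm_length_swap _ q p (val v) lt_qp.
    by rewrite vp vq tpermC -def_u => /(_ lt_ab); rewrite ltnNge le_uv.
  rewrite (big_pred1 (p, q)) => [|[p' q']]; first by rewrite /F /= vp vq.
  apply/and3P/eqP => /= [[lt_pq' _ /eqP]|[-> ->]]; last by rewrite vp vq def_u.
  by rewrite def_u => /mulIg; apply: tperm_lt_inj.
rewrite (eq_bigr _ labelE).
rewrite (exchange_big_dep (fun pq => nc_descent (val v) pq.1 pq.2)) /=;
  last first.
  by move=> u [p q] _ /and3P[lt_pq lt_v /eqP def_u];
    rewrite /nc_descent lt_pq lt_v -def_u (valP u).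
rewrite /descent_product [RHS]pair_big_dep /=;
  apply: eq_bigr => -[p q] /and3P[/= lt_pq lt_v nc_u].
rewrite (big_pred1 (Sub _ nc_u : NC n)) // => u; rewrite /C /= lt_pq lt_v /=.
rewrite -[RHS](inj_eq val_inj) SubK andb_idl // => /eqP def_u; apply/andP;
  split.
  apply/existsP; exists (val v q, val v p);
    rewrite /differ_by /= lt_v def_u tperm_mulC.
  by rewrite [tperm (sval v q) _]tpermC -mulgA tperm2 mulg1 eqxx.
apply/connect1/bruhat_stepP; exists p, q.
by rewrite -[val u]/(sval u) def_u mulgA tperm2 mul1g !permM tpermL tpermR;
  split.
Qed.

(** The short insertion is shorter than [ForToNC F], so that the value there
    vanishes and the comparison of the two insertions leaves one product. *)
Lemma forest_diagonal (P : forall n : nat, Forest n -> 'Ztx[n, n])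
    (hP : double_forest_polynomials P) n (F : Forest n) :
  (0 < n)%N -> nc_arcs (ForToNC F) ->
  ev (ForToNC F) (P _ F) = descent_product (ForToNC F).
Proof.
elim: n F => // m IHm F _ nc.
have [->|/nonempty_is_grown[G [i def_F]]] := eqVneq F (empty_forest m.+1).
  have [_ evP _ _] := hP _ (empty_forest m.+1).
  rewrite ForToNC_empty ev1 evP eqxx /descent_product big1 // => p _.
  by rewrite big1 // => q /and3P[lt_pq]; rewrite !perm1; lia.
have def_v := ForToNC_grow G i.
move: nc; rewrite def_F def_v => /nc_long_insert nc.
rewrite (descent_product_long_insert _ nc) -IHm //;
  last exact: leq_ltn_trans (ltn_ord i).
have [_ _ /(_ i G (erefl _)) grown _] := hP _ (grow G i).
rewrite ev_long_insert grown ev_skip_t.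
have -> : ev (short_insert i (ForToNC G)) (P _ (grow G i)) = 0;
  last by rewrite add0r.
apply/eqP; rewrite -[_ == _]negbK; apply/negP => /(forest_vanishing hP).
rewrite def_v => /(_ isT) le_long.
have /bruhat_length := le_long (proj2 (nc_short_insert _ _) nc).
by have /andP[_] := short_long_step i (ForToNC G); lia.
Qed.

Lemma NCToForK n (v : NC n) : ForToNC (NCToFor v) = val v.
Proof.
rewrite /NCToFor; case: pickP => [F /eqP //|noF].
have /is_NCP nc := valP v; have [F eqF] := ForToNC_surj nc.
by have := noF F; rewrite eqF eqxx.
Qed.

Theorem theorem11p11 (P : forall n : nat, Forest n -> 'Ztx[n, n])
    (hP : double_forest_polynomials P) (n : nat) (hn : (0 < n)%N) :
  @flowup_basis n (cayley_NC n) (@NC_bruhat n) (@forest_class P n).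
Proof.
split=> [v|v w|v].
- exact: graph_cohomology_ev.
- apply: contraNeq => ne0; rewrite /NC_bruhat -(NCToForK v).
  apply: forest_vanishing ne0 => //; exact/is_NCP/(valP w).
exists false; rewrite mul1r lower_labels_product /forest_class -(NCToForK v).
by apply: forest_diagonal; rewrite // NCToForK; apply/is_NCP/(valP v).
Qed.
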